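(* Let $M$ be a 7-dimensional Riemannian manifold with holonomy contained in $G_2$, and let $Y\subset M$ be an associative submanifold with normal bundle $\nu$. Then, as operators on $\Gamma(Y,\nu)$, $$D^2 = \nabla^{\perp *}\nabla^\perp + \mathcal R - \mathcal A .$$
   Context: $M$ carries a parallel nondegenerate 3-form $\phi$ (the $G_2$-form, inducing the metric $\langle\cdot,\cdot\rangle$), and a vector product $\times$ on $TM$ defined by $\langle u\times v,w\rangle=\phi(u,v,w)$. A 3-dimensional submanifold $Y$ is associative if $TY$ is stable under $\times$, equivalently (with the appropriate orientation) $\phi|_Y$ is the Riemannian volume form of $Y$; then $TY\times\nu\subset\nu$. $\nabla$ is the Levi-Civita connection of $M$, $\nabla^\top$ and $\nabla^\perp$ are its projections to $TY$ and to the normal bundle $\nu$; $R(w,z)=\nabla_w\nabla_z-\nabla_z\nabla_w-\nabla_{[w,z]}$ is the curvature tensor of $M$. Let $(e_1,e_2,e_3)$ be a local orthonormal frame of $TY$. Definitions (all operators $\Gamma(Y,\nu)\to\Gamma(Y,\nu)$, independent of the frame): - $D\psi=\sum_{i=1}^3 e_i\times\nabla^\perp_{e_i}\psi$. - $\nabla^{\perp 2}_{v,w}=\nabla^\perp_v\nabla^\perp_w-\nabla^\perp_{\nabla^\top_v w}$ for $v,w\in\Gamma(Y,TY)$, and $\nabla^{\perp *}\nabla^\perp=-\sum_i\nabla^{\perp2}_{e_i,e_i}$. - $\mathcal R\psi=\pi_\nu\sum_{i=1}^3 R(e_i,\psi)e_i$, with $\pi_\nu$ the orthogonal projection to $\nu$.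 - $\mathcal A=A^t\circ A$, where $A\in\mathrm{Hom}(\nu,SY)$, $SY$ is the bundle of symmetric endomorphisms of $TY$ (with its standard trace inner product), $A(\psi)(u)=-\nabla^\top_u\psi$, and $A^t$ is the transpose of $A$. *)

(* Defs.v *)
From mathcomp Require Import all_boot all_order all_algebra.
From mathcomp Require Import all_classical all_reals all_analysis.
Set Implicit Arguments.
Unset Strict Implicit.
Unset Printing Implicit Defensive.
Import Order.TTheory GRing.Theory Num.Theory.
Import numFieldNormedType.Exports.
Local Open Scope classical_set_scope.
Local Open Scope ring_scope.

Fixpoint Ck_on (R : realType) (m : nat) (W : normedModType R) (k : nat)
    (U : set 'rV[R]_m.+1) (f : 'rV[R]_m.+1 -> W) : Prop :=
  match k with
  | 0%N => forall x, U x -> {for x, continuous f}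
  | k'.+1 => (forall x, U x -> differentiable f x) /\
             (forall v, Ck_on k' U (fun x => 'D_v f x))
  end.

(* Used only for open U. *)
Definition smooth_on (R : realType) (m : nat) (W : normedModType R)
    (U : set 'rV[R]_m.+1) (f : 'rV[R]_m.+1 -> W) : Prop :=
  forall k, Ck_on k U f.

(* [chart_coord] and [chart_inv] are total functions, meaningful only on
   [chart_dom] and on [chart_coord @` chart_dom] respectively. *)
Record chart (R : realType) (M : topologicalType) := Chart {
  chart_dom : set M;
  chart_coord : M -> 'rV[R]_7;
  chart_inv : 'rV[R]_7 -> M;
  chart_dom_open : open chart_dom;
  chart_image_open : open (chart_coord @` chart_dom);
  chart_coordK : forall p, chart_dom p -> chart_inv (chart_coord p) = p;
  chart_coord_continuous :
    forall p, chart_dom p -> {for p, continuous chart_coord};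
  chart_inv_continuous :
    forall x, (chart_coord @` chart_dom) x -> {for x, continuous chart_inv}
}.

Definition chart_image (R : realType) (M : topologicalType) (c : chart R M)
    (O : set M) : set 'rV[R]_7 := chart_coord c @` (chart_dom c `&` O).

Definition transition (R : realType) (M : topologicalType) (c c' : chart R M) :
    'rV[R]_7 -> 'rV[R]_7 := chart_coord c' \o chart_inv c.

Definition compatible (R : realType) (M : topologicalType)
    (c c' : chart R M) : Prop :=
  smooth_on (chart_image c (chart_dom c')) (transition c c') /\
  smooth_on (chart_image c' (chart_dom c)) (transition c' c).

Record smooth_manifold (R : realType) (M : topologicalType)
    (atlas : set (chart R M)) : Prop := SmoothManifold {
  manifold_hausdorff : hausdorff_space M;
  manifold_second_countable : @second_countable M;
  atlas_cover : forall p : M, exists2 c, atlas c & chart_dom c p;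
  atlas_compatible : forall c c', atlas c -> atlas c' -> compatible c c';
  atlas_maximal :
    forall c, (forall c', atlas c' -> compatible c c') -> atlas c
}.

(* A tangent vector at p is a family of component vectors, one for each chart
   around p, related by the differentials of the transition maps.  A vector
   field is accordingly a family of component functions of the coordinates. *)
Definition tm_field (R : realType) (M : topologicalType) : Type :=
  chart R M -> 'rV[R]_7 -> 'rV[R]_7.

(* The differential at p of the change of coordinates from c to c'. *)
Definition dtrans (R : realType) (M : topologicalType) (c c' : chart R M)
    (p : M) (v : 'rV[R]_7) : 'rV[R]_7 :=
  'd (transition c c') (chart_coord c p) v.

Definition inner (R : realType) (G : 'M[R]_7) (u v : 'rV[R]_7) : R :=
  (u *m G *m v^T) 0 0.

Definition metric_field (R : realType) (M : topologicalType) : Type :=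
  chart R M -> 'rV[R]_7 -> 'M[R]_7.

Record riemannian_metric (R : realType) (M : topologicalType)
    (atlas : set (chart R M)) (g : metric_field R M) : Prop :=
  RiemannianMetric {
  metric_smooth : forall c, atlas c -> smooth_on (chart_image c setT) (g c);
  metric_sym : forall c p, atlas c -> chart_dom c p ->
    (g c (chart_coord c p))^T = g c (chart_coord c p);
  metric_pos : forall c p u, atlas c -> chart_dom c p -> u != 0 ->
    0 < inner (g c (chart_coord c p)) u u;
  metric_change : forall c c' p u v, atlas c -> atlas c' ->
    chart_dom c p -> chart_dom c' p ->
    inner (g c (chart_coord c p)) u v =
    inner (g c' (chart_coord c' p)) (dtrans c c' p u) (dtrans c c' p v)
}.

(* The vector Z with inner G Z w = \sum_l a_l w_l. *)
Definition sharp (R : realType) (G : 'M[R]_7) (a : 'rV[R]_7) : 'rV[R]_7 :=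
  a *m invmx G.

Definition basis_vec (R : realType) (l : 'I_7) : 'rV[R]_7 := delta_mx 0 l.

(* Christoffel symbols from the Koszul formula for constant fields u, v, w:
   2 <nabla_u v, w> = u<v, w> + v<u, w> - w<u, v>. *)
Definition christoffel (R : realType) (G : 'rV[R]_7 -> 'M[R]_7)
    (x u v : 'rV[R]_7) : 'rV[R]_7 :=
  sharp (G x)
    (2^-1 *: \row_l (inner ('D_u G x) v (basis_vec R l)
                     + inner ('D_v G x) u (basis_vec R l)
                     - inner ('D_(basis_vec R l) G x) u v)).

(* (nabla_v s)(x) in a chart.  When v is tangent to a submanifold that is
   linear in the chart, 'D_v s x only involves the values of s on the
   submanifold, so that the same formula is the connection induced on the
   restriction of TM to the submanifold. *)
Definition nabla (R : realType) (G : 'rV[R]_7 -> 'M[R]_7) (v : 'rV[R]_7)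
    (s : 'rV[R]_7 -> 'rV[R]_7) (x : 'rV[R]_7) : 'rV[R]_7 :=
  'D_v s x + christoffel G x v (s x).

Definition lie_bracket (R : realType) (W Z : 'rV[R]_7 -> 'rV[R]_7)
    (x : 'rV[R]_7) : 'rV[R]_7 := 'D_(W x) Z x - 'D_(Z x) W x.

Definition curvature_fields (R : realType) (G : 'rV[R]_7 -> 'M[R]_7)
    (W Z U : 'rV[R]_7 -> 'rV[R]_7) (x : 'rV[R]_7) : 'rV[R]_7 :=
  nabla G (W x) (fun y => nabla G (Z y) U y) x
  - nabla G (Z x) (fun y => nabla G (W y) U y) x
  - nabla G (lie_bracket W Z x) U x.

(* The tensor R(w, z)u at x, vectors being extended by constants. *)
Definition curvature_tensor (R : realType) (G : 'rV[R]_7 -> 'M[R]_7)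
    (x w z u : 'rV[R]_7) : 'rV[R]_7 :=
  curvature_fields G (fun=> w) (fun=> z) (fun=> u) x.

Definition form3_field (R : realType) (M : topologicalType) : Type :=
  chart R M -> 'rV[R]_7 -> 'rV[R]_7 -> 'rV[R]_7 -> 'rV[R]_7 -> R.

(* dx_i /\ dx_j /\ dx_k, with indices starting from 0. *)
Definition dx3 (R : realType) (i j k : nat) (u v w : 'rV[R]_7) : R :=
  \det (\matrix_(a < 3, b < 3)
          (nth 0 [:: u; v; w] a) 0 (inord (nth 0%N [:: i; j; k] b))).

(* The standard 3-form on R^7, whose stabilizer in GL_7(R) is G2. *)
Definition phi0 (R : realType) (u v w : 'rV[R]_7) : R :=
  dx3 0 1 2 u v w + dx3 0 3 4 u v w + dx3 0 5 6 u v w + dx3 1 3 5 u v w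
  - dx3 1 4 6 u v w - dx3 2 3 6 u v w - dx3 2 4 5 u v w.

(* phi is a parallel 3-form, pointwise isomorphic to phi0 in a g-orthonormal
   basis (the rows of F).  [form_parallel] is
   (nabla_z phi)(u, v, w) = 0 on constant fields u, v, w. *)
Record parallel_G2_form (R : realType) (M : topologicalType)
    (atlas : set (chart R M)) (g : metric_field R M) (phi : form3_field R M) :
    Prop := ParallelG2Form {
  form_smooth : forall c u v w, atlas c ->
    smooth_on (W := R) (chart_image c setT) (fun x => phi c x u v w);
  form_change : forall c c' p u v w, atlas c -> atlas c' ->
    chart_dom c p -> chart_dom c' p ->
    phi c (chart_coord c p) u v w =
    phi c' (chart_coord c' p)
      (dtrans c c' p u) (dtrans c c' p v) (dtrans c c' p w);
  form_G2 : forall c p, atlas c -> chart_dom c p ->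
    exists F : 'M[R]_7, F *m g c (chart_coord c p) *m F^T = 1%:M /\
      forall u v w,
        phi c (chart_coord c p) (u *m F) (v *m F) (w *m F) = phi0 u v w;
  form_parallel : forall c x z u v w, atlas c -> chart_image c setT x ->
    'D_z (fun y => phi c y u v w : R) x
    - phi c x (christoffel (g c) x z u) v w
    - phi c x u (christoffel (g c) x z v) w
    - phi c x u v (christoffel (g c) x z w) = 0
}.

(* inner (g c x) (cross_product g phi c x u v) w = phi c x u v w *)
Definition cross_product (R : realType) (M : topologicalType)
    (g : metric_field R M)
    (phi : form3_field R M) (c : chart R M) (x u v : 'rV[R]_7) : 'rV[R]_7 :=
  sharp (g c x) (\row_l phi c x u v (basis_vec R l)).

(* The rows span R^3 x 0 in R^7. *)
Definition slice_mx (R : realType) : 'M[R]_(3, 7) := pid_mx 3.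

(* In such a chart T_pY is the row space of [slice_mx] for all p in Y. *)
Definition adapted (R : realType) (M : topologicalType)
    (atlas : set (chart R M)) (Y : set M) (c : chart R M) : Prop :=
  atlas c /\
  forall p, chart_dom c p -> (Y p <-> (chart_coord c p <= slice_mx R)%MS).

Definition submanifold3 (R : realType) (M : topologicalType)
    (atlas : set (chart R M)) (Y : set M) : Prop :=
  forall p, Y p -> exists2 c, adapted atlas Y c & chart_dom c p.

Definition associative_submanifold (R : realType) (M : topologicalType)
    (atlas : set (chart R M)) (g : metric_field R M) (phi : form3_field R M)
    (Y : set M) : Prop :=
  submanifold3 atlas Y /\
  forall c p u v, adapted atlas Y c -> chart_dom c p -> Y p ->
    (u <= slice_mx R)%MS -> (v <= slice_mx R)%MS ->
    (cross_product g phi c (chart_coord c p) u v <= slice_mx R)%MS.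

(* s is smooth as a function on the points of R^3 x 0 lying in the open set U;
   its values elsewhere are irrelevant. *)
Definition smooth_along (R : realType) (U : set 'rV[R]_7)
    (s : 'rV[R]_7 -> 'rV[R]_7) : Prop :=
  smooth_on (W := 'rV[R]_7) [set t : 'rV[R]_3 | U (t *m slice_mx R)]
    (fun t => s (t *m slice_mx R)).

(* Smooth sections of TM restricted to the open subset Y `&` O of Y.  Only the
   components in adapted charts, at points of Y, are meaningful. *)
Definition smooth_section (R : realType) (M : topologicalType)
    (atlas : set (chart R M)) (Y O : set M) (s : tm_field R M) : Prop :=
  (forall c, adapted atlas Y c -> smooth_along (chart_image c O) (s c)) /\
  (forall c c' p, adapted atlas Y c -> adapted atlas Y c' ->
     chart_dom c p -> chart_dom c' p -> Y p -> O p ->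
     s c' (chart_coord c' p) = dtrans c c' p (s c (chart_coord c p))).

Definition tangent_section (R : realType) (M : topologicalType)
    (atlas : set (chart R M)) (Y O : set M) (s : tm_field R M) : Prop :=
  smooth_section atlas Y O s /\
  forall c p, adapted atlas Y c -> chart_dom c p -> Y p -> O p ->
    (s c (chart_coord c p) <= slice_mx R)%MS.

Definition normal_vector (R : realType) (G : 'M[R]_7) (n : 'rV[R]_7) : Prop :=
  forall u, (u <= slice_mx R)%MS -> inner G n u = 0.

Definition normal_section (R : realType) (M : topologicalType)
    (atlas : set (chart R M)) (g : metric_field R M) (Y O : set M)
    (s : tm_field R M) : Prop :=
  smooth_section atlas Y O s /\
  forall c p, adapted atlas Y c -> chart_dom c p -> Y p -> O p ->
    normal_vector (g c (chart_coord c p)) (s c (chart_coord c p)).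

Definition orthonormal_frame (R : realType) (M : topologicalType)
    (atlas : set (chart R M)) (g : metric_field R M) (Y O : set M)
    (e : 'I_3 -> tm_field R M) : Prop :=
  (forall i, tangent_section atlas Y O (e i)) /\
  forall c p i j, adapted atlas Y c -> chart_dom c p -> Y p -> O p ->
    inner (g c (chart_coord c p))
      (e i c (chart_coord c p)) (e j c (chart_coord c p))
    = (i == j)%:R.

(* G-orthogonal projection onto the row space of [slice_mx]. *)
Definition proj_tangent (R : realType) (G : 'M[R]_7) (v : 'rV[R]_7) :
    'rV[R]_7 :=
  let P := slice_mx R in
  v *m G *m P^T *m invmx (P *m G *m P^T) *m P.

Definition proj_normal (R : realType) (G : 'M[R]_7) (v : 'rV[R]_7) :
    'rV[R]_7 := v - proj_tangent G v.

Definition nabla_tan (R : realType) (G : 'rV[R]_7 -> 'M[R]_7) (v : 'rV[R]_7)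
    (s : 'rV[R]_7 -> 'rV[R]_7) (x : 'rV[R]_7) : 'rV[R]_7 :=
  proj_tangent (G x) (nabla G v s x).

Definition nabla_perp (R : realType) (G : 'rV[R]_7 -> 'M[R]_7) (v : 'rV[R]_7)
    (s : 'rV[R]_7 -> 'rV[R]_7) (x : 'rV[R]_7) : 'rV[R]_7 :=
  proj_normal (G x) (nabla G v s x).

Definition dirac_op (R : realType) (M : topologicalType) (g : metric_field R M)
    (phi : form3_field R M) (e : 'I_3 -> tm_field R M) (psi : tm_field R M) :
    tm_field R M :=
  fun c x =>
    \sum_i cross_product g phi c x (e i c x)
             (nabla_perp (g c) (e i c x) (psi c) x).

Definition nabla_perp2 (R : realType) (M : topologicalType)
    (g : metric_field R M) (v w : tm_field R M) (psi : tm_field R M) :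
    tm_field R M :=
  fun c x =>
    nabla_perp (g c) (v c x)
      (fun y => nabla_perp (g c) (w c y) (psi c) y) x
    - nabla_perp (g c) (nabla_tan (g c) (v c x) (w c) x) (psi c) x.

Definition rough_laplacian (R : realType) (M : topologicalType)
    (g : metric_field R M) (e : 'I_3 -> tm_field R M) (psi : tm_field R M) :
    tm_field R M :=
  fun c x => - \sum_i nabla_perp2 g (e i) (e i) psi c x.

Definition ricci_normal (R : realType) (M : topologicalType)
    (g : metric_field R M) (e : 'I_3 -> tm_field R M) (psi : tm_field R M) :
    tm_field R M :=
  fun c x => proj_normal (g c x)
    (\sum_i curvature_tensor (g c) x (e i c x) (psi c x) (e i c x)).

(* A(s) at x, as an endomorphism of T_xY, for s a local normal section. *)
Definition shape_op (R : realType) (G : 'rV[R]_7 -> 'M[R]_7)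
    (s : 'rV[R]_7 -> 'rV[R]_7) (x : 'rV[R]_7) : 'rV[R]_7 -> 'rV[R]_7 :=
  fun u => - nabla_tan G u s x.

(* tr(B^t C) in the orthonormal basis e. *)
Definition trace_inner (R : realType) (G : 'M[R]_7) (e : 'I_3 -> 'rV[R]_7)
    (B C : 'rV[R]_7 -> 'rV[R]_7) : R := \sum_i inner G (B (e i)) (C (e i)).

(* A^t(B) at x: the unique normal vector n such that
   <n, eta> = <B, A(eta)> for all local normal sections eta around x. *)
Definition shape_transpose (R : realType) (M : topologicalType)
    (g : metric_field R M) (e : 'I_3 -> tm_field R M) (c : chart R M)
    (x : 'rV[R]_7) (B : 'rV[R]_7 -> 'rV[R]_7) : 'rV[R]_7 :=
  xget 0 [set n : 'rV[R]_7 | normal_vector (g c x) n /\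
    forall (U : set 'rV[R]_7) (eta : 'rV[R]_7 -> 'rV[R]_7),
      open U -> U x -> U `<=` chart_image c setT -> smooth_along U eta ->
      (forall y, U y -> (y <= slice_mx R)%MS ->
         normal_vector (g c y) (eta y)) ->
      inner (g c x) n (eta x) =
      trace_inner (g c x) (fun i => e i c x) B (shape_op (g c) eta x)].

Definition shape_squared (R : realType) (M : topologicalType)
    (g : metric_field R M) (e : 'I_3 -> tm_field R M) (psi : tm_field R M) :
    tm_field R M :=
  fun c x => shape_transpose g e c x (shape_op (g c) (psi c) x).

(* Main.v *)
From HB Require Import structures.
Require Import Defs.
From mathcomp Require Import all_boot all_order all_algebra.
From mathcomp Require Import all_classical all_reals all_analysis.
From mathcomp Require Import ring lra.
Import Order.TTheory GRing.Theory Num.Theory.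
Import numFieldNormedType.Exports.
Local Open Scope classical_set_scope.
Local Open Scope ring_scope.

Set Implicit Arguments.
Unset Strict Implicit.
Unset Printing Implicit Defensive.

(** The identity is local: in an adapted chart Y is an open part of a linear
    3-dimensional slice of R^7, and a section of the normal bundle is a function
    of the slice parameter.

    Write x for the vector product, e_i for the frame, X_j for
    nabla^perp_{e_j} psi and B for the second fundamental form. The product is
    parallel because the form is, the tangent space of Y is closed under it, and
    the product of two normal vectors is tangent; hence nabla^perp obeys the
    Leibniz rule for tangent x normal, and the derivatives of the frame cancel
    because its connection matrix is antisymmetric ([dirac_derivative]). This
    gives D^2 psi = sum_ij e_i x (e_j x H_ij), where H_ij is
    (nabla^perp)^2_{e_i, e_j} psi. On normal vectors (e_i x)^2 = -1 and
    e_i x (e_j x _) = - (e_i x e_j) x _, so the diagonal terms form the rough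
    Laplacian, and the others only involve H_ij - H_ji ([clifford_sum]).

    By the Ricci equation ([normal_hessian_comm]) and the Bianchi identity,
    H_ij - H_ji is the normal part of r_ij - r_ji minus s_ij - s_ji, with
    r_ij = R(e_i, psi) e_j and s_ij = B(A(psi)(e_i), e_j). Both R(e_i, psi)
    ([curv_cross]) and B(A(psi)(e_i), _) ([second_form_derivation]) are
    derivations of the vector product, the former because the product is
    parallel, the latter because moreover TY is closed under it. With
    e_i x e_j = lam e_k for cyclic (i, j, k) and lam = 1 or -1, the derivation
    property turns the cyclic sum of the e_k x (r_ij - r_ji) into the trace
    sum_i r_ii up to sign ([derivation_sum]), and likewise for s. The first
    trace is the curvature term, and the second is A^t A psi, by differentiating
    the orthogonality of normal and tangent fields ([trace_shape]).

    At a point, all that is used of the G2-form is the identity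
    u x (u x w) = - |u|^2 w + <u, w> u, a polynomial identity for the standard
    form ([standard_vector_product]). The analysis consists of product rules for
    fields with moving coefficients and of Schwarz's theorem ([derive_comm]),
    applied to psi and to the vector product. *)

(** * Smooth functions on open sets of R^n *)

Lemma near_eq_differentiable (R : numFieldType) (V W : normedModType R)
    (f g : V -> W) (x : V) :
  (\near x, f x = g x) -> differentiable f x -> differentiable g x.
Proof.
move=> fg df.
have fxgx : f x = g x := nbhs_singleton fg.
have cdf := diff_continuous df.
have Dg : g \o shift x = cst (g x) + 'd f x +o_ 0 id.
  have /diff_locally/eqaddoP Df := df.
  apply/eqaddoP => eps eps0; have := Df eps eps0.
  have fg0 : \forall y \near (0 : V), f (y + x) = g (y + x).
    by have := fg; rewrite (near_shift 0 x) /= => /filterS; apply => y /=;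
      rewrite subr0.
  move=> H; near=> y.
  have E : f (y + x) = g (y + x).
    near: y; exact: fg0.
  have : `|[eta f \o shift x - (cst (f x) + 'd f x)] y| <= eps * `|id y|
    by near: y.
  by rewrite /= /GRing.add /GRing.opp /= E fxgx.
apply/diff_locallyP.
by rewrite (diff_unique cdf Dg).
Unshelve. all: by end_near. Qed.

Section CkCalculus.
Context {R : realType} {m : nat}.
Implicit Types (U : set 'rV[R]_m.+1).
Notation E := 'rV[R]_m.+1.

Lemma near_open_eq (T : Type) U (f g : E -> T) (x : E) : open U -> U x ->
  (forall y, U y -> f y = g y) -> \near x, f x = g x.
Proof. by move=> oU Ux fg; apply: filterS fg _; exact: open_nbhs_nbhs. Qed.

Lemma Ck_on_eq (W : normedModType R) k U (f g : E -> W) : open U ->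
  (forall x, U x -> f x = g x) -> Ck_on k U f -> Ck_on k U g.
Proof.
move=> oU; elim: k f g => [|k IH] f g fg /=.
  move=> cf x Ux; have := cf x Ux; rewrite /prop_for /continuous_at -(fg x Ux).
  have H := near_open_eq oU Ux fg.
  apply: cvg_trans.
  exact: near_eq_cvg H.
move=> [df cf]; split=> [x Ux|v].
  by apply: near_eq_differentiable (df x Ux); apply: near_open_eq oU Ux fg.
apply: IH (cf v) => x Ux; apply: near_eq_derive.
exact: near_open_eq oU Ux fg.
Qed.

Lemma Ck_onW (W : normedModType R) k U (f : E -> W) :
  Ck_on k.+1 U f -> Ck_on k U f.
Proof.
elim: k f => [|k IH] f [df cf].
  by move=> x Ux; apply/differentiable_continuous/df.
by split=> // v; apply: IH.
Qed.

Lemma Ck_on_cst (W : normedModType R) k U (w : W) : Ck_on k U (fun _ : E => w).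
Proof.
elim: k w => [|k IH] w /=; first by move=> x _; exact: cst_continuous.
split=> [x _|v]; first exact: differentiable_cst.
suff -> : 'D_v (fun _ : E => w) = fun=> 0 by exact: IH.
by apply/funext=> x; exact: derive_cst.
Qed.

Lemma Ck_on_add (W : normedModType R) k U (f g : E -> W) : open U ->
  Ck_on k U f -> Ck_on k U g -> Ck_on k U (fun x => f x + g x).
Proof.
move=> oU; elim: k f g => [|k IH] f g.
  by move=> cf cg x Ux; apply: continuousD; [exact: cf|exact: cg].
move=> [df cf] [dg cg]; split=> [x Ux|v].
  by apply: differentiableD; [exact: df|exact: dg].
apply: (Ck_on_eq oU _ (IH _ _ (cf v) (cg v))) => x Ux.
by rewrite -deriveD//; apply: diff_derivable; [exact: df|exact: dg].
Qed.

Lemma Ck_on_linear (W W' : normedModType R) (L : {linear W -> W'}) k U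
    (f : E -> W) : open U -> continuous L ->
  Ck_on k U f -> Ck_on k U (fun x => L (f x)).
Proof.
move=> oU cL; elim: k f => [|k IH] f.
  move=> cf x Ux; apply: (@continuous_comp _ _ _ f L); [exact: cf|exact: cL].
have dL y : differentiable L y by exact/linear_differentiable.
move=> [df cf]; split=> [x Ux|v].
  by apply: (@differentiable_comp _ _ _ _ f L) => //; exact: df.
apply: (Ck_on_eq oU _ (IH _ (cf v))) => x Ux.
have dfx := df x Ux.
rewrite -[RHS]/('D_v (L \o f) x) (deriveE _ (differentiable_comp dfx (dL _))).
by rewrite diff_comp //= (diff_lin _ cL) (deriveE _ dfx).
Qed.

Lemma Ck_on_mul k U (f g : E -> R) : open U ->
  Ck_on k U f -> Ck_on k U g -> Ck_on k U (fun x => f x * g x).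
Proof.
move=> oU; elim: k f g => [|k IH] f g.
  by move=> cf cg x Ux; apply: continuousM; [exact: cf|exact: cg].
move=> Cf Cg; have [df cf] := Cf; have [dg cg] := Cg; split=> [x Ux|v].
  by apply: differentiableM; [exact: df|exact: dg].
have C := Ck_on_add oU (IH _ _ (Ck_onW Cf) (cg v)) (IH _ _ (Ck_onW Cg) (cf v)).
apply: (Ck_on_eq oU _ C) => x Ux.
by rewrite deriveM//; apply: diff_derivable; [exact: df|exact: dg].
Qed.

Lemma Ck_on_inv k U (f : E -> R) : open U -> (forall x, U x -> f x != 0) ->
  Ck_on k U f -> Ck_on k U (fun x => (f x)^-1).
Proof.
move=> oU f0; elim: k => [|k IH].
  by move=> cf x Ux; apply: continuousV; [exact: f0|exact: cf].
move=> Cf; have [df cf] := Cf; split=> [x Ux|v].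
  by apply: differentiableV; [exact: df|exact: f0].
have C1 := IH (Ck_onW Cf).
have C := Ck_on_mul oU (Ck_on_cst k U (-1 : R)) 
  (Ck_on_mul oU (Ck_on_mul oU C1 C1) (cf v)).
apply: (Ck_on_eq oU _ C) => x Ux.
rewrite deriveV ?f0//; last by apply: diff_derivable; exact: df.
by rewrite scaleNr mulN1r expr2 invfM.
Qed.

Lemma smooth_on_eq (W : normedModType R) U (f g : E -> W) : open U ->
  (forall x, U x -> f x = g x) -> smooth_on U f -> smooth_on U g.
Proof. by move=> oU fg sf k; apply: Ck_on_eq (sf k). Qed.

Lemma smooth_on_cst (W : normedModType R) U (w : W) :
  smooth_on U (fun _ : E => w).
Proof. by move=> k; exact: Ck_on_cst. Qed.

Lemma smooth_on_add (W : normedModType R) U (f g : E -> W) : open U ->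
  smooth_on U f -> smooth_on U g -> smooth_on U (fun x => f x + g x).
Proof. by move=> oU sf sg k; apply: Ck_on_add. Qed.

Lemma smooth_on_linear (W W' : normedModType R) (L : {linear W -> W'}) U
    (f : E -> W) : open U -> continuous L ->
  smooth_on U f -> smooth_on U (fun x => L (f x)).
Proof. by move=> oU cL sf k; apply: Ck_on_linear. Qed.

Lemma smooth_on_mul U (f g : E -> R) : open U ->
  smooth_on U f -> smooth_on U g -> smooth_on U (fun x => f x * g x).
Proof. by move=> oU sf sg k; apply: Ck_on_mul. Qed.

Lemma smooth_on_inv U (f : E -> R) : open U -> (forall x, U x -> f x != 0) ->
  smooth_on U f -> smooth_on U (fun x => (f x)^-1).
Proof. by move=> oU f0 sf k; apply: Ck_on_inv. Qed.

Lemma smooth_on_derive (W : normedModType R) U (f : E -> W) v :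
  smooth_on U f -> smooth_on U ('D_v f).
Proof. by move=> sf k; have [_ cf] := sf k.+1; exact: cf. Qed.

Lemma smooth_on_differentiable (W : normedModType R) U (f : E -> W) x :
  smooth_on U f -> U x -> differentiable f x.
Proof. by move=> sf; have [df _] := sf 1%N; exact: df. Qed.

Lemma smooth_on_sum (W : normedModType R) (I : Type) (r : seq I) U
    (f : I -> E -> W) : open U -> (forall i, smooth_on U (f i)) ->
  smooth_on U (fun x => \sum_(i <- r) f i x).
Proof.
move=> oU sf; elim: r => [|i r IH].
  apply: (smooth_on_eq oU _ (smooth_on_cst U 0)) => x _.
  by rewrite big_nil.
apply: (smooth_on_eq oU _ (smooth_on_add oU (sf i) IH)) => x _.
by rewrite big_cons.
Qed.

Lemma smooth_on_prod (I : Type) (r : seq I) U (f : I -> E -> R) : open U ->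
  (forall i, smooth_on U (f i)) ->
  smooth_on U (fun x => \prod_(i <- r) f i x).
Proof.
move=> oU sf; elim: r => [|i r IH].
  apply: (smooth_on_eq oU _ (smooth_on_cst U (1 : R))) => x _.
  by rewrite big_nil.
apply: (smooth_on_eq oU _ (smooth_on_mul oU (sf i) IH)) => x _.
by rewrite big_cons.
Qed.

Lemma smooth_on_scalel (W : normedModType R) U (f : E -> R) (w : W) : open U ->
  smooth_on U f -> smooth_on U (fun x => f x *: w).
Proof.
move=> oU sf.
have sx_lin : linear ( *:%R ^~ w : R -> W).
  by move=> a u v; rewrite scalerDl scalerA.
pose sxlM := GRing.isLinear.Build _ _ _ _ _ sx_lin.
pose sxL : {linear R -> W} := HB.pack ( *:%R ^~ w : R -> W) sxlM.
by apply: (@smooth_on_linear _ _ sxL _ _ oU _ sf); exact: scalel_continuous.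
Qed.

Lemma smooth_on_mx p q U (f : E -> 'M[R]_(p.+1, q.+1)) : open U ->
  (forall i j, smooth_on U (fun x => f x i j)) -> smooth_on U f.
Proof.
move=> oU sf.
have S : smooth_on U
    (fun x => \sum_i \sum_j f x i j *: (delta_mx i j : 'M[R]_(p.+1, q.+1))).
  do 2![apply: smooth_on_sum => // ?].
  exact: smooth_on_scalel.
by apply: (smooth_on_eq oU _ S) => x _; rewrite -matrix_sum_delta.
Qed.

Lemma smooth_on_entry p q U (f : E -> 'M[R]_(p.+1, q.+1)) i j : open U ->
  smooth_on U f -> smooth_on U (fun x => f x i j).
Proof.
move=> oU sf.
have @L : {linear 'M[R]_(p.+1, q.+1) -> R}.
  by exists (fun N : 'M[R]_(_, _) => N i j); do 2![eexists]; do ?[constructor];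
     rewrite ?mxE// => ? *; rewrite ?mxE//; move=> ?; rewrite !mxE.
have cL : continuous L by move=> N; exact: (@coord_continuous R _ _ i j N).
exact: (@smooth_on_linear _ _ L _ _ oU cL sf).
Qed.

End CkCalculus.

Section LinearSubstitution.
Context {R : realType} {m n : nat} (P : 'M[R]_(n.+1, m.+1)).

Lemma derive_comp_linear (W : normedModType R) (f : 'rV[R]_m.+1 -> W)
    (t v : 'rV[R]_n.+1) :
  'D_v (fun s => f (s *m P)) t = 'D_(v *m P) f (t *m P).
Proof.
rewrite /derive.
have E (h : R) : (((fun s => f (s *m P)) \o shift t) (h *: v) : W) =
    (f \o shift (t *m P)) (h *: (v *m P)).
  by rewrite /= mulmxDl -scalemxAl.
by under eq_fun do rewrite E.
Qed.

Lemma differentiable_mulmxr (t : 'rV[R]_n.+1) :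
  differentiable (fun s : 'rV[R]_n.+1 => s *m P) t.
Proof.
have -> : (fun s : 'rV[R]_n.+1 => s *m P) = 
    \sum_(i < n.+1) (fun s : 'rV[R]_n.+1 => s 0 i *: row i P).
  by apply/funext => s; rewrite mulmx_sum_row fct_sumE.
apply: differentiable_sum => i.
by apply: differentiableZl; exact: differentiable_coord.
Qed.

Lemma continuous_mulmxr : continuous (fun s : 'rV[R]_n.+1 => s *m P).
Proof. by move=> t; apply/differentiable_continuous/differentiable_mulmxr. Qed.

Lemma Ck_on_comp_linear (W : normedModType R) k U (f : 'rV[R]_m.+1 -> W) :
  Ck_on k U f -> Ck_on k [set t | U (t *m P)] (fun t => f (t *m P)).
Proof.
elim: k f => [|k IH] f.
  move=> cf t Ut;
    apply: (@continuous_comp _ _ _ (fun s : 'rV[R]_n.+1 => s *m P) f t).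
    exact: continuous_mulmxr.
  exact: cf.
move=> [df cf]; split=> [t Ut|v].
  apply: (@differentiable_comp _ _ _ _ (fun s : 'rV[R]_n.+1 => s *m P) f t).
    exact: differentiable_mulmxr.
  exact: df.
rewrite (_ : 'D_v _ = fun t => 'D_(v *m P) f (t *m P));
  first exact: (IH _ (cf _)).
by apply/funext => t; exact: derive_comp_linear.
Qed.

Lemma smooth_on_comp_linear (W : normedModType R) U (f : 'rV[R]_m.+1 -> W) :
  smooth_on U f -> smooth_on [set t | U (t *m P)] (fun t => f (t *m P)).
Proof. by move=> sf k; exact: Ck_on_comp_linear. Qed.

Lemma open_comp_linear (U : set 'rV[R]_m.+1) :
  open U -> open [set t : 'rV[R]_n.+1 | U (t *m P)].
Proof.
move=> oU; apply: (open_comp _ oU) => t _; exact: continuous_mulmxr.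
Qed.

End LinearSubstitution.

(** * Matrices of smooth functions, mixed derivatives and product rules *)

Section SmoothMatrix.
Context {R : realType} {m : nat}.
Notation E := 'rV[R]_m.+1.
Variables (U : set E) (oU : open U).

(** Stated on entries, since determinants, adjugates and inverses are built from
    scalar sums and products of entries. *)
Definition smooth_mx p q (A : E -> 'M[R]_(p, q)) : Prop :=
  forall i j, smooth_on U (fun x => A x i j).

Lemma smooth_mx_cst p q (A : 'M[R]_(p, q)) : smooth_mx (fun=> A).
Proof. by move=> i j; exact: smooth_on_cst. Qed.

Lemma smooth_mx_eq p q (A B : E -> 'M[R]_(p, q)) :
  (forall x, U x -> A x = B x) -> smooth_mx A -> smooth_mx B.
Proof.
by move=> AB sA i j; apply: (smooth_on_eq oU _ (sA i j)) => x Ux; rewrite AB.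
Qed.

Lemma smooth_mx_scale p q (a : E -> R) (B : E -> 'M[R]_(p, q)) :
  smooth_on U a -> smooth_mx B -> smooth_mx (fun x => a x *: B x).
Proof.
move=> sa sB i j.
apply: (smooth_on_eq oU _ (smooth_on_mul oU sa (sB i j))) => x _.
by rewrite mxE.
Qed.

Lemma smooth_mx_mul p q r (A : E -> 'M[R]_(p, q)) (B : E -> 'M[R]_(q, r)) :
  smooth_mx A -> smooth_mx B -> smooth_mx (fun x => A x *m B x).
Proof.
move=> sA sB i j.
have S : smooth_on U (fun x => \sum_k A x i k * B x k j).
  by apply: smooth_on_sum => // k; exact: smooth_on_mul.
by apply: (smooth_on_eq oU _ S) => x _; rewrite mxE.
Qed.

Lemma smooth_on_det p (A : E -> 'M[R]_p) :
  smooth_mx A -> smooth_on U (fun x => \det (A x)).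
Proof.
move=> sA; apply: smooth_on_sum => // s; apply: smooth_on_mul => //.
  exact: smooth_on_cst.
exact: smooth_on_prod.
Qed.

Lemma smooth_mx_adj p (A : E -> 'M[R]_p) :
  smooth_mx A -> smooth_mx (fun x => \adj (A x)).
Proof.
move=> sA i j.
have S : smooth_on U (fun x => cofactor (A x) j i).
  apply: smooth_on_mul => //; first exact: smooth_on_cst.
  apply: smooth_on_det => k l.
  have := sA (lift j k) (lift i l).
  by apply: smooth_on_eq => // x _; rewrite !mxE.
by apply: (smooth_on_eq oU _ S) => x _; rewrite mxE.
Qed.

(** Cramer's rule: the adjugate and the determinant are polynomials in the
    entries. *)
Lemma smooth_mx_inv p (A : E -> 'M[R]_p) :
  (forall x, U x -> A x \in unitmx) -> smooth_mx A ->
  smooth_mx (fun x => invmx (A x)).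
Proof.
move=> uA sA.
have S : smooth_mx (fun x => (\det (A x))^-1 *: \adj (A x)).
  apply: smooth_mx_scale; last exact: smooth_mx_adj.
  apply: smooth_on_inv => //; last exact: smooth_on_det.
  by move=> x Ux; have := uA x Ux; rewrite unitmxE unitfE.
by apply: (smooth_mx_eq _ S) => x Ux; rewrite /invmx uA.
Qed.

Lemma smooth_mx_row q (f : 'I_q -> E -> R) : (forall l, smooth_on U (f l)) ->
  smooth_mx (fun x => \row_l f l x).
Proof.
by move=> sf i j; apply: (smooth_on_eq oU _ (sf j)) => x _; rewrite mxE.
Qed.

Lemma smooth_mx_derive p q (A : E -> 'M[R]_(p.+1, q.+1)) v :
  smooth_mx A -> smooth_mx ('D_v A).
Proof.
move=> sA i j; apply: (smooth_on_entry i j oU).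
exact/smooth_on_derive/smooth_on_mx.
Qed.

End SmoothMatrix.

Section SymmetryOfSecondDerivatives.
Context {R : realType} {m : nat}.
Notation E := 'rV[R]_m.+1.

Lemma is_derive_line (W : normedModType R) (f : E -> W) (y u : E) (s : R) :
  derivable f (s *: u + y) u ->
  is_derive s 1 (fun r : R => f (r *: u + y)) ('D_u f (s *: u + y)).
Proof.
move=> /derivableP [df Ef].
have E0 (h : R) :
    ((fun r : R => f (r *: u + y)) \o shift s) (h *: (1 : R)) =
    (f \o shift (s *: u + y)) (h *: u).
  by rewrite /= scalerDl addrA; congr (f (_ *: u + _ + _)); exact: mulr1.
apply: DeriveDef.
  by rewrite /derivable; under eq_fun do rewrite E0; exact: df.
by rewrite /derive; under eq_fun do rewrite E0.
Qed.

(** The mean value theorem in the direction u, then in the direction v, turns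
    the second difference over the parallelogram into a value of the mixed
    derivative at a point inside it. *)
Lemma second_difference (U : set E) (f : E -> R) (x u v : E) (h : R) :
  0 < h -> smooth_on U f ->
  (forall s t, 0 <= s <= h -> 0 <= t <= h -> U (s *: u + (t *: v + x))) ->
  exists s t, [/\ 0 <= s <= h, 0 <= t <= h &
    (f (h *: u + (h *: v + x)) - f (h *: u + x))
    - (f (h *: v + x) - f x)
    = 'D_v ('D_u f) (s *: u + (t *: v + x)) * h * h].
Proof.
move=> h0 sf Ub.
have dU k y : smooth_on U k -> U y -> forall w, derivable (k : E -> R) y w.
  by move=> sk Uy w; apply/diff_derivable/(smooth_on_differentiable sk).
have le0h : 0 <= (0 : R) <= h by apply/andP; split=> //; exact: ltW.
have lehh : 0 <= h <= h by apply/andP; split=> //; exact: ltW.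
pose g := fun s : R => f (s *: u + (h *: v + x)) - f (s *: u + x).
pose dg := fun s : R => 'D_u f (s *: u + (h *: v + x)) - 'D_u f (s *: u + x).
have Dg s : 0 <= s <= h -> is_derive s 1 g (dg s).
  move=> sh; apply: is_deriveB; apply: is_derive_line; apply: dU => //.
    exact: Ub.
  by have := Ub s 0 sh le0h; rewrite scale0r add0r.
have [||s sh Es] := MVT_segment (df := dg) (ltW h0) (f := g).
- by move=> s; rewrite in_itv /= => /andP[s0 s1]; apply: Dg; rewrite !ltW.
- apply: derivable_within_continuous => s; rewrite in_itv /= => sh.
  by have [] := Dg s sh.
have {}sh : 0 <= s <= h by move: sh; rewrite in_itv.
pose k := fun t : R => 'D_u f (t *: v + (s *: u + x)).
pose dk := fun t : R => 'D_v ('D_u f) (t *: v + (s *: u + x)).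
have sDf := smooth_on_derive u sf.
have Dk t : 0 <= t <= h -> is_derive t 1 k (dk t).
  move=> th; apply: is_derive_line; apply: dU => //.
  by rewrite addrCA; exact: Ub.
have [||t th Et] := MVT_segment (df := dk) (ltW h0) (f := k).
- by move=> t; rewrite in_itv /= => /andP[t0 t1]; apply: Dk; rewrite !ltW.
- apply: derivable_within_continuous => t; rewrite in_itv /= => th.
  by have [] := Dk t th.
have {}th : 0 <= t <= h by move: th; rewrite in_itv.
exists s, t; split=> //.
move: Es Et; rewrite /g /dg /k /dk !subr0 !scale0r !add0r.
rewrite (addrCA (h *: v)) (addrCA (t *: v)).
by rewrite opprD opprK => -> ->.
Qed.

Lemma common_modulus (U : set E) (A B : E -> R) (x : E) (eps : R) : 0 < eps ->
  nbhs x U -> {for x, continuous A} -> {for x, continuous B} ->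
  exists2 r, 0 < r & forall y, ball x r y ->
    [/\ U y, `|A x - A y| <= eps & `|B x - B y| <= eps].
Proof.
move=> eps0 Ux cA cB.
have /nbhs_ballP[r /= r0 Br] : \forall y \near x,
    [/\ U y, `|A x - A y| <= eps & `|B x - B y| <= eps].
  near=> y; split; near: y => //.
    by move/cvgrPdist_le : cA; exact.
  by move/cvgrPdist_le : cB; exact.
by exists r.
Unshelve. all: by end_near. Qed.

(** Schwarz's theorem. The second difference is symmetric in u and v, so the two
    mixed derivatives take a common value in every small parallelogram at x (at
    different points of it), and both are continuous at x. *)
Lemma derive_comm (U : set E) (f : E -> R) (x u v : E) : open U -> U x ->
  smooth_on U f -> 'D_u ('D_v f) x = 'D_v ('D_u f) x.
Proof.
move=> oU Ux sf.
have cont k : smooth_on U k -> {for x, continuous (k : E -> R)}.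
  by move=> sk; apply: differentiable_continuous;
    exact: smooth_on_differentiable sk Ux.
have cuv := cont _ (smooth_on_derive u (smooth_on_derive v sf)).
have cvu := cont _ (smooth_on_derive v (smooth_on_derive u sf)).
apply/eqP; rewrite -subr_eq0 -normr_le0; apply/ler_addgt0Pr => eps eps0.
rewrite add0r.
have e2 : 0 < eps / 2 by rewrite divr_gt0.
have [r r0 Br] := common_modulus e2 (open_nbhs_nbhs (conj oU Ux)) cuv cvu.
(* h is such that the parallelogram of side h spanned by u and v at x lies in
   the ball of radius r. *)
pose D := `|u| + `|v| + 1.
have D0 : 0 < D by rewrite ltr_wpDl// addr_ge0.
pose h := r / D / 2.
have h0 : 0 < h by rewrite !divr_gt0.
have near_x s t : 0 <= s <= h -> 0 <= t <= h ->
    ball x r (s *: u + (t *: v + x)).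
  move=> /andP[s0 sh] /andP[t0 th].
  rewrite -ball_normE /ball_ /= addrA opprD addrCA subrr addr0 normrN.
  apply: le_lt_trans (ler_normD _ _) _; rewrite !normrZ !ger0_norm//.
  apply: (@le_lt_trans _ _ (h * D)).
    rewrite /D mulrDr mulrDr mulr1 -[X in X <= _]addr0.
    by rewrite !lerD// ?ler_wpM2r// ltW.
  rewrite /h mulrAC divfK ?gt_eqF//.
  by rewrite ltr_pdivrMr// mulr_natr mulr2n ltrDl.
have [s [t [sh th E1]]] := second_difference h0 sf
  (fun s t sh th => let: And3 a _ _ := Br _ (near_x s t sh th) in a).
have near_x' s' t' : 0 <= s' <= h -> 0 <= t' <= h ->
    ball x r (s' *: v + (t' *: u + x)).
  by move=> sh' th'; rewrite addrCA; exact: near_x.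
have [s' [t' [sh' th' E2]]] := second_difference h0 sf
  (fun s t sh th => let: And3 a _ _ := Br _ (near_x' s t sh th) in a).
have [_ _ A] := Br _ (near_x s t sh th).
have [_ B _] := Br _ (near_x' s' t' sh' th').
move: E1 A E2 B; rewrite (addrCA (h *: v)).
move: ('D_v ('D_u f) (s *: u + (t *: v + x))) => P E1 A.
move: ('D_u ('D_v f) (s' *: v + (t' *: u + x))) => Q E2.
have -> : Q = P.
  have hn : h * h != 0 by rewrite mulf_neq0 ?gt_eqF.
  have Eh : Q * (h * h) = P * (h * h).
    by rewrite (mulrA Q) (mulrA P) -E1 -E2; ring.
  exact: (mulIf hn Eh).
move: A; move: ('D_v ('D_u f) x) ('D_u ('D_v f) x) => A0 B0 A B.
rewrite -(subrKA P) (le_trans (ler_normD _ _))//.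
by rewrite [leRHS]splitr lerD// distrC.
Qed.

Lemma derive_comm_row n (U : set E) (f : E -> 'rV[R]_n.+1) (x u v : E) :
  open U -> U x -> smooth_on U f -> 'D_u ('D_v f) x = 'D_v ('D_u f) x.
Proof.
move=> oU Ux sf.
have key a b i : 'D_a ('D_b f) x 0 i = 'D_a ('D_b (fun y => f y 0 i)) x.
  have dDf := smooth_on_differentiable (smooth_on_derive b sf) Ux.
  rewrite (derive_mx (diff_derivable (v := a) dDf)) mxE.
  apply: near_eq_derive; apply: near_open_eq oU Ux _ => y Uy.
  have df := smooth_on_differentiable sf Uy.
  by rewrite (derive_mx (diff_derivable (v := b) df)) mxE.
apply/rowP => i.
apply: etrans (key u v i) (etrans _ (esym (key v u i))).
exact: derive_comm oU Ux (smooth_on_entry 0 i oU sf).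
Qed.

End SymmetryOfSecondDerivatives.

Section BilinearDerivative.
Context {R : realType} {m p q : nat}.
Notation E := 'rV[R]_m.+1.

Lemma linear_row (n : nat) (W : lmodType R) (L : 'rV[R]_n -> W) :
  (forall a u v, L (a *: u + v) = a *: L u + L v) ->
  forall u, L u = \sum_k u 0 k *: L (delta_mx 0 k).
Proof.
move=> lin u.
pose LM := GRing.isLinear.Build _ _ _ _ L lin.
pose LL : {linear 'rV[R]_n -> W} := HB.pack L LM.
rewrite [in LHS](row_sum_delta u) -[L]/(LL : _ -> _) linear_sum.
by apply: eq_bigr => k _; rewrite linearZ.
Qed.

Lemma derive_mul3 (f g h : E -> R) (x z : E) :
  derivable f x z -> derivable g x z -> derivable h x z ->
  'D_z (fun y => f y * g y * h y) x =
  f x * g x * 'D_z h x + 'D_z f x * g x * h x + f x * 'D_z g x * h x.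
Proof.
move=> df dg dh; rewrite -[fun y => _]/(f * g * h).
rewrite (deriveM (derivableM df dg) dh) (deriveM df dg) /GRing.scale /=.
rewrite -[(f * g) x]/(f x * g x); ring.
Qed.

(** Expanding B in the standard bases leaves only products of three scalar
    functions to differentiate. Bilinearity is asked on U only: off the domain
    of the metric, the Christoffel symbols need not be bilinear. *)
Lemma derive_bilinear_form (U : set E)
    (B : E -> 'rV[R]_p.+1 -> 'rV[R]_q.+1 -> R)
    (a : E -> 'rV[R]_p.+1) (b : E -> 'rV[R]_q.+1) (x : E) : open U -> U x ->
  (forall y c u v w, U y -> B y (c *: u + v) w = c * B y u w + B y v w) ->
  (forall y c u v w, U y -> B y w (c *: u + v) = c * B y w u + B y w v) ->
  (forall u v, differentiable (fun y => B y u v) x) ->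
  differentiable a x -> differentiable b x ->
  differentiable (fun y => B y (a y) (b y)) x /\
  forall z, 'D_z (fun y => B y (a y) (b y)) x =
    'D_z (fun y => B y (a x) (b x)) x + B x ('D_z a x) (b x)
    + B x (a x) ('D_z b x).
Proof.
move=> oU Ux Bl Br dB da db.
have BE y u v : U y -> B y u v =
    \sum_k \sum_l u 0 k * v 0 l * B y (delta_mx 0 k) (delta_mx 0 l).
  move=> Uy.
  rewrite (@linear_row _ R^o (fun u => B y u v)); last by move=> *; exact: Bl.
  apply: eq_bigr => k _.
  rewrite (@linear_row _ R^o (B y (delta_mx 0 k))); last by move=> *; exact: Br.
  by rewrite scaler_sumr; apply: eq_bigr => l _; rewrite /GRing.scale /= mulrA.
have coord n (c : E -> 'rV[R]_n.+1) k : differentiable c x ->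
    differentiable (fun y => c y 0 k) x.
  move=> dc; apply: (@differentiable_comp _ _ _ _ c (fun M => M 0 k)) => //.
  exact: differentiable_coord.
have rule (a' : E -> 'rV[R]_p.+1) (b' : E -> 'rV[R]_q.+1) :
    differentiable a' x -> differentiable b' x ->
    differentiable (fun y => B y (a' y) (b' y)) x /\
    forall z, 'D_z (fun y => B y (a' y) (b' y)) x =
     \sum_k \sum_l
      ((a' x 0 k * b' x 0 l)
        * 'D_z (fun y => B y (delta_mx 0 k) (delta_mx 0 l)) x
       + ('D_z a' x) 0 k * b' x 0 l * B x (delta_mx 0 k) (delta_mx 0 l)
       + a' x 0 k * ('D_z b' x) 0 l * B x (delta_mx 0 k) (delta_mx 0 l)).
  move=> da' db'.
  pose T k l (y : E) := a' y 0 k * b' y 0 l * B y (delta_mx 0 k) (delta_mx 0 l).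
  have dT k l : differentiable (T k l) x.
    apply: differentiableM => //; apply: differentiableM => //; exact: coord.
  have dTT k : differentiable (\sum_l T k l) x by apply: differentiable_sum.
  have ET : \forall y \near x, (\sum_k \sum_l T k l) y = B y (a' y) (b' y).
    apply: near_open_eq oU Ux _ => y Uy; rewrite BE // fct_sumE.
    by apply: eq_bigr => k _; rewrite fct_sumE.
  split=> [|z].
    by apply: near_eq_differentiable ET _; exact: differentiable_sum.
  rewrite -(near_eq_derive z ET).
  rewrite derive_sum; last by move=> k; exact: diff_derivable.
  apply: eq_bigr => k _.
  rewrite derive_sum; last by move=> l; exact: diff_derivable.
  apply: eq_bigr => l _.
  have dak := diff_derivable (v := z) (coord _ _ k da').
  have dbl := diff_derivable (v := z) (coord _ _ l db').
  have dBkl := diff_derivable (v := z) (dB (delta_mx 0 k) (delta_mx 0 l)).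
  have Eak := congr1 (fun M : 'rV_p.+1 => M 0 k)
    (derive_mx (diff_derivable (v := z) da')).
  have Ebl := congr1 (fun M : 'rV_q.+1 => M 0 l)
    (derive_mx (diff_derivable (v := z) db')).
  rewrite !mxE in Eak Ebl; rewrite Eak Ebl {Eak Ebl}.
  exact: derive_mul3 dak dbl dBkl.
have [dd Dd] := rule a b da db.
split=> // z.
rewrite Dd.
have [_ ->] := rule (fun=> a x) (fun=> b x) (differentiable_cst _ _)
  (differentiable_cst _ _).
rewrite !derive_cst (BE x ('D_z a x))// (BE x (a x) ('D_z b x))//.
rewrite -!big_split; apply: eq_bigr => k _ /=.
rewrite -!big_split; apply: eq_bigr => l _ /=.
by rewrite !mxE; ring.
Qed.

Lemma derive_rowP n (f : E -> 'rV[R]_n.+1) x :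
  (forall i, differentiable (fun y => f y 0 i) x) ->
  differentiable f x /\
  forall z i, ('D_z f x) 0 i = 'D_z (fun y => f y 0 i) x.
Proof.
move=> df; have Df : differentiable f x.
  have -> : f = \sum_i (fun y => f y 0 i *: delta_mx 0 i).
    by apply/funext => y; rewrite fct_sumE -row_sum_delta.
  by apply: differentiable_sum => i; exact: differentiableZl.
by split=> // z i; rewrite (derive_mx (diff_derivable (v := z) Df)) mxE.
Qed.

Lemma derive_bilinear n (U : set E)
    (B : E -> 'rV[R]_p.+1 -> 'rV[R]_q.+1 -> 'rV[R]_n.+1)
    (a : E -> 'rV[R]_p.+1) (b : E -> 'rV[R]_q.+1) (x : E) : open U -> U x ->
  (forall y c u v w, U y -> B y (c *: u + v) w = c *: B y u w + B y v w) ->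
  (forall y c u v w, U y -> B y w (c *: u + v) = c *: B y w u + B y w v) ->
  (forall u v, differentiable (fun y => B y u v) x) ->
  differentiable a x -> differentiable b x ->
  differentiable (fun y => B y (a y) (b y)) x /\
  forall z, 'D_z (fun y => B y (a y) (b y)) x =
    'D_z (fun y => B y (a x) (b x)) x + B x ('D_z a x) (b x)
    + B x (a x) ('D_z b x).
Proof.
move=> oU Ux Bl Br dB da db.
have dBi i u v : differentiable (fun y => B y u v 0 i) x.
  apply: (@differentiable_comp _ _ _ _ (fun y => B y u v) (fun M => M 0 i)) =>
    //.
  exact: differentiable_coord.
have Bli i y c u v w : U y ->
    B y (c *: u + v) w 0 i = c * B y u w 0 i + B y v w 0 i.
  by move=> Uy; rewrite Bl // !mxE.
have Bri i y c u v w : U y ->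
    B y w (c *: u + v) 0 i = c * B y w u 0 i + B y w v 0 i.
  by move=> Uy; rewrite Br // !mxE.
have S i := derive_bilinear_form oU Ux (Bli i) (Bri i) (dBi i) da db.
have [D E1] := derive_rowP (fun i => (S i).1).
split=> // z; apply/rowP => i; rewrite !mxE E1 (S i).2.
by rewrite (derive_mx (diff_derivable (v := z) (dB _ _))) mxE.
Qed.

End BilinearDerivative.

(** The case of [derive_bilinear] where the second argument is the constant
    1 in R. *)
Lemma derive_linear_family (R : realType) (m p n : nat) (U : set 'rV[R]_m.+1)
    (L : 'rV[R]_m.+1 -> 'rV[R]_p.+1 -> 'rV[R]_n.+1)
    (a : 'rV[R]_m.+1 -> 'rV[R]_p.+1) (x : 'rV[R]_m.+1) : open U -> U x ->
  (forall y c u v, U y -> L y (c *: u + v) = c *: L y u + L y v) ->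
  (forall u, differentiable (fun y => L y u) x) ->
  differentiable a x ->
  differentiable (fun y => L y (a y)) x /\
  forall z, 'D_z (fun y => L y (a y)) x =
    'D_z (fun y => L y (a x)) x + L x ('D_z a x).
Proof.
move=> oU Ux Ll dL da.
pose B y (u : 'rV[R]_p.+1) (s : 'rV[R]_1) := s 0 0 *: L y u.
have one : (const_mx 1 : 'rV[R]_1) 0 0 = 1 by rewrite mxE.
have EB y u : B y u (const_mx 1) = L y u by rewrite /B one scale1r.
have [|||||d D] := @derive_bilinear R m p 0 n U B a (fun=> const_mx 1) x oU Ux.
- by move=> y c u v w Uy; rewrite /B Ll // scalerDr !scalerA mulrC.
- by move=> y c u v w _; rewrite /B !mxE scalerDl scalerA.
- by move=> u v; apply: differentiableZ.
- exact: da.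
- exact: differentiable_cst.
have EL (b : 'rV[R]_m.+1 -> 'rV[R]_p.+1) :
    (fun y => B y (b y) (const_mx 1)) = (fun y => L y (b y)).
  by apply/funext => y; exact: EB.
rewrite EL in d; split=> // z; have := D z.
rewrite EL (EL (fun=> a x)) derive_cst EB => ->.
by rewrite /B mxE scale0r addr0.
Qed.

(** * Vector products and associative 3-planes *)

(** The algebra that a G2-form induces on a tangent space. [vp_double] is
    u x (u x w) = - |u|^2 w + <u, w> u in polarized form. *)
Record vector_product (R : realType) (V : lmodType R) (ip : V -> V -> R)
    (cr : V -> V -> V) : Prop := VectorProduct {
  vp_ipC : forall u v, ip u v = ip v u;
  vp_ip_linear : forall a u v w, ip (a *: u + v) w = a * ip u w + ip v w;
  vp_ip_gt0 : forall u, u != 0 -> 0 < ip u u;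
  vp_cr_linear : forall a u v w, cr (a *: u + v) w = a *: cr u w + cr v w;
  vp_crC : forall u v, cr u v = - cr v u;
  vp_ip_cr : forall u v w, ip (cr u v) w = ip u (cr v w);
  vp_double : forall u v w, cr u (cr v w) + cr v (cr u w) =
    - (2 * ip u v) *: w + ip u w *: v + ip v w *: u
}.

Definition i0 : 'I_3 := @Ordinal 3 0 isT.
Definition i1 : 'I_3 := @Ordinal 3 1 isT.
Definition i2 : 'I_3 := @Ordinal 3 2 isT.

Lemma sum3 (V : nmodType) (F : 'I_3 -> V) : \sum_i F i = F i0 + F i1 + F i2.
Proof.
rewrite !big_ord_recr big_ord0 /= add0r.
by congr (F _ + F _ + F _); apply/val_inj.
Qed.

Section AssociativeAlgebra.
Context {R : realType} {V : lmodType R} {ip : V -> V -> R} {cr : V -> V -> V}.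
Hypothesis vp : vector_product ip cr.

Lemma ipDl u v w : ip (u + v) w = ip u w + ip v w.
Proof. by have := vp_ip_linear vp 1 u v w; rewrite scale1r mul1r. Qed.
Lemma ip0l w : ip 0 w = 0.
Proof. by have := ipDl 0 0 w; rewrite addr0 => /eqP;
  rewrite -subr_eq0 opprD addNKr oppr_eq0 => /eqP. Qed.
Lemma ipZl a u w : ip (a *: u) w = a * ip u w.
Proof. by have := vp_ip_linear vp a u 0 w; rewrite addr0 ip0l addr0. Qed.
Lemma ipNl u w : ip (- u) w = - ip u w.
Proof. by rewrite -scaleN1r ipZl mulN1r. Qed.
Lemma ipDr u v w : ip w (u + v) = ip w u + ip w v.
Proof. by rewrite !(vp_ipC vp w) ipDl. Qed.
Lemma ipZr a u w : ip w (a *: u) = a * ip w u.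
Proof. by rewrite !(vp_ipC vp w) ipZl. Qed.
Lemma ipNr u w : ip w (- u) = - ip w u.
Proof. by rewrite !(vp_ipC vp w) ipNl. Qed.
Lemma ip0r w : ip w 0 = 0.
Proof. by rewrite (vp_ipC vp) ip0l. Qed.

Lemma crDl u v w : cr (u + v) w = cr u w + cr v w.
Proof. by have := vp_cr_linear vp 1 u v w; rewrite !scale1r. Qed.
Lemma cr0l w : cr 0 w = 0.
Proof. by have := crDl 0 0 w; rewrite addr0 => /eqP;
  rewrite -subr_eq0 opprD addNKr oppr_eq0 => /eqP. Qed.
Lemma crZl a u w : cr (a *: u) w = a *: cr u w.
Proof. by have := vp_cr_linear vp a u 0 w; rewrite addr0 cr0l addr0. Qed.
Lemma crNl u w : cr (- u) w = - cr u w.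
Proof. by rewrite -scaleN1r crZl scaleN1r. Qed.
Lemma crDr u v w : cr w (u + v) = cr w u + cr w v.
Proof. by rewrite !(vp_crC vp w) crDl opprD. Qed.
Lemma crZr a u w : cr w (a *: u) = a *: cr w u.
Proof. by rewrite !(vp_crC vp w) crZl scalerN. Qed.
Lemma crNr u w : cr w (- u) = - cr w u.
Proof. by rewrite !(vp_crC vp w) crNl. Qed.
Lemma cr0r w : cr w 0 = 0.
Proof. by rewrite (vp_crC vp) cr0l oppr0. Qed.

Local Notation ipE := (ipDl, ipZl, ipNl, ip0l).
Local Notation ipEr := (ipDr, ipZr, ipNr, ip0r).
Local Notation crE := (crDl, crZl, crNl, cr0l, crDr, crZr, crNr, cr0r).

(** Identities between vectors are reduced by this lemma to identities between
    scalars. *)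
Lemma ip_inj u v : (forall w, ip u w = ip v w) -> u = v.
Proof.
move=> uv; apply/eqP; rewrite -subr_eq0; apply/negPn/negP => /(vp_ip_gt0 vp).
by rewrite ipDl ipNl uv subrr ltxx.
Qed.

Lemma crvv u : cr u u = 0.
Proof.
have := vp_crC vp u u => /eqP; rewrite -addr_eq0 -mulr2n -scaler_nat.
by rewrite scaler_eq0 pnatr_eq0 => /eqP.
Qed.

Lemma ip_crC u v w : ip (cr u v) w = - ip (cr u w) v.
Proof. by rewrite !(vp_ip_cr vp) (vp_crC vp v w) ipNr. Qed.

Lemma cross_twice u v : cr u (cr u v) = - ip u u *: v + ip u v *: u.
Proof.
have H := vp_double vp u u v.
have two : (2 : R) != 0 by rewrite pnatr_eq0.
apply: (scalerI two); apply: ip_inj => w.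
have /= := congr1 (ip ^~ w) H; rewrite !ipE => E.
by rewrite mulr_natl mulr2n E; ring.
Qed.

(* The span of e plays the role of TY, its orthogonal that of the normal space;
   [closed_e] says that the span is associative. *)
Variable e : 'I_3 -> V.
Hypothesis orthonormal_e : forall i j, ip (e i) (e j) = (i == j)%:R.

Definition tangential (v : V) : V := \sum_i ip v (e i) *: e i.
Definition normal_part (v : V) : V := v - tangential v.
Definition is_normal (n : V) : Prop := forall i, ip n (e i) = 0.

Hypothesis closed_e : forall i j, tangential (cr (e i) (e j)) = cr (e i) (e j).

Lemma tangentialD u v : tangential (u + v) = tangential u + tangential v.
Proof. by rewrite -big_split; apply: eq_bigr => i _; rewrite ipDl scalerDl. Qed.
Lemma tangentialZ a v : tangential (a *: v) = a *: tangential v.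
Proof. by rewrite scaler_sumr; apply: eq_bigr => i _; rewrite ipZl scalerA. Qed.
Lemma normal_partD u v : normal_part (u + v) = normal_part u + normal_part v.
Proof. by rewrite /normal_part tangentialD opprD addrACA. Qed.
Lemma normal_partZ a v : normal_part (a *: v) = a *: normal_part v.
Proof. by rewrite /normal_part tangentialZ scalerBr. Qed.
Lemma normal_partN v : normal_part (- v) = - normal_part v.
Proof. by rewrite -scaleN1r normal_partZ scaleN1r. Qed.

Lemma tangential_frame i : tangential (e i) = e i.
Proof.
rewrite /tangential (bigD1 i) //=
  orthonormal_e eqxx scale1r big1 ?addr0 // => j.
by rewrite orthonormal_e eq_sym => /negPf ->; rewrite scale0r.
Qed.

Lemma ip_tangential_frame v i : ip (tangential v) (e i) = ip v (e i).
Proof.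
rewrite (vp_ipC vp);
  have -> : ip (e i) (tangential v) = \sum_j ip v (e j) * ip (e i) (e j).
  rewrite /tangential (big_morph (ip (e i)) (fun x y => ipDr x y _) (ip0r _)).
  by apply: eq_bigr => j _; rewrite ipZr.
rewrite (bigD1 i) //= orthonormal_e eqxx mulr1 big1 ?addr0 // => j.
by rewrite orthonormal_e eq_sym => /negPf ->; rewrite mulr0.
Qed.

Lemma tangential_idem v : tangential (tangential v) = tangential v.
Proof. by rewrite {1}/tangential; under eq_bigr do rewrite ip_tangential_frame.
Qed.

Lemma normal_part_normal v : is_normal (normal_part v).
Proof. by move=> i; rewrite ipDl ipNl ip_tangential_frame subrr. Qed.

Lemma tangential_normal n : is_normal n -> tangential n = 0.
Proof. by move=> nn; apply: big1 => i _; rewrite nn scale0r. Qed.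

Lemma normal_part_id n : is_normal n -> normal_part n = n.
Proof. by move=> nn; rewrite /normal_part tangential_normal ?subr0. Qed.

Lemma normal_part_tangent t : tangential t = t -> normal_part t = 0.
Proof. by rewrite /normal_part => ->; rewrite subrr. Qed.

Lemma ip_normal_tangent n t : is_normal n -> tangential t = t -> ip n t = 0.
Proof.
move=> nn <-; rewrite (big_morph (ip n) (fun x y => ipDr x y n) (ip0r n)).
by rewrite big1 // => i _; rewrite ipZr nn mulr0.
Qed.

Lemma cr_frame_normal i n : is_normal n -> is_normal (cr (e i) n).
Proof.
move=> nn j; rewrite ip_crC (vp_ipC vp) (ip_normal_tangent nn) ?oppr0//.
Qed.

(** e_i x preserves both the tangent and the normal space. *)
Lemma normal_part_cr_frame i v :
  normal_part (cr (e i) v) = cr (e i) (normal_part v).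
Proof.
have -> : cr (e i) v = cr (e i) (normal_part v) + cr (e i) (tangential v).
  by rewrite -crDr subrK.
rewrite normal_partD
  (normal_part_id (cr_frame_normal i (normal_part_normal v))).
rewrite [X in _ + X]normal_part_tangent ?addr0 //.
have -> : cr (e i) (tangential v) = \sum_j ip v (e j) *: cr (e i) (e j).
  rewrite /tangential (big_morph (cr (e i)) (fun x y => crDr x y (e i))
    (cr0r (e i))).
  by apply: eq_bigr => j _; rewrite crZr.
rewrite (big_morph tangential tangentialD (_ : tangential 0 = 0)).
  by apply: eq_bigr => j _; rewrite tangentialZ closed_e.
by apply: tangential_normal => j; rewrite ip0l.
Qed.

Lemma cr_frame_sq i n : is_normal n -> cr (e i) (cr (e i) n) = - n.
Proof.
move=> nn; rewrite cross_twice orthonormal_e eqxx (vp_ipC vp) nn scale0r addr0.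
by rewrite scaleN1r.
Qed.

Lemma cr_frame_anti (i j : 'I_3) n : i != j -> is_normal n ->
  cr (e i) (cr (e j) n) = - cr (e j) (cr (e i) n).
Proof.
move=> ij nn; apply/eqP; rewrite -addr_eq0 (vp_double vp) !(vp_ipC vp _ n) !nn.
by rewrite orthonormal_e (negPf ij) mulr0 oppr0 !scale0r !addr0.
Qed.

(** When u, v, w are mutually orthogonal the right-hand side of [vp_double]
    vanishes, so u x (v x w) changes sign when two neighbouring arguments are
    exchanged; a normal n is orthogonal to the whole frame. *)
Lemma cr_frame_assoc (i j : 'I_3) n : i != j -> is_normal n ->
  cr (e i) (cr (e j) n) = - cr (cr (e i) (e j)) n.
Proof.
move=> ij nn.
have H := vp_double vp n (e j) (e i).
rewrite !nn orthonormal_e eq_sym (negPf ij) in H.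
rewrite mulr0 oppr0 !scale0r !addr0 in H.
have E : cr (cr (e i) (e j)) n = cr n (cr (e j) (e i)).
  by rewrite (vp_crC vp (e i)) crNl [RHS](vp_crC vp).
rewrite (cr_frame_anti ij nn) E; congr (- _).
move/eqP: H; rewrite addr_eq0 => /eqP ->.
by rewrite (vp_crC vp n) crNr opprK.
Qed.

(** The operator J = e_i x _ passes from the first to the third slot of the form
    <a x b, c> on normal vectors: by [vp_double], b x (J c) + J (b x c) is a
    multiple of e_i, hence orthogonal to a. *)
Lemma form_normal_slide13 i a b c : is_normal a -> is_normal b -> is_normal c ->
  ip (cr (cr (e i) a) b) c = ip (cr a b) (cr (e i) c).
Proof.
move=> na nb nc.
have /= H := congr1 (ip a) (vp_double vp b (e i) c).
rewrite !ipEr !na nb (vp_ipC vp (e i)) nc in H.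
move: H; rewrite -!(vp_ip_cr vp) (vp_crC vp a (e i)) crNl !ipE => H.
by apply/eqP; rewrite eq_sym -subr_eq0 H; apply/eqP; ring.
Qed.

Lemma form_normal_slide12 i a b c : is_normal a -> is_normal b -> is_normal c ->
  ip (cr (cr (e i) a) b) c = ip (cr a (cr (e i) b)) c.
Proof.
by move=> na nb nc; rewrite ip_crC form_normal_slide13// -ip_crC.
Qed.

(** Sliding J_i and J_j to different slots, in either order, gives
    <J_i J_j a x b, c> = <J_j J_i a x b, c>. Since J_i and J_j anticommute, this
    value is 0, and J_i J_j is onto the normal space. *)
Lemma form_normal (i j : 'I_3) a b c : i != j ->
  is_normal a -> is_normal b -> is_normal c -> ip (cr a b) c = 0.
Proof.
move=> ij na nb nc.
have nJ k v : is_normal v -> is_normal (cr (e k) v) := @cr_frame_normal k v.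
have E d : is_normal d -> ip (cr (cr (e i) (cr (e j) d)) b) c = 0.
  move=> nd.
  have : ip (cr (cr (e i) (cr (e j) d)) b) c =
    ip (cr (cr (e j) (cr (e i) d)) b) c.
    rewrite (form_normal_slide13 i (nJ j d nd) nb nc).
    rewrite (form_normal_slide12 j nd nb (nJ i c nc)).
    rewrite (form_normal_slide12 j (nJ i d nd) nb nc).
    by rewrite (form_normal_slide13 i nd (nJ j b nb) nc).
  rewrite (cr_frame_anti ij nd) crNl ipNl => /eqP.
  by rewrite eq_sym -addr_eq0 -mulr2n mulrn_eq0 => /eqP ->; rewrite oppr0.
have := E (cr (e j) (cr (e i) a)) (nJ _ _ (nJ _ _ na)).
by rewrite cr_frame_sq ?crNr ?cr_frame_sq ?opprK; auto.
Qed.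

Lemma cr_normal n n' : is_normal n -> is_normal n' ->
  normal_part (cr n n') = 0.
Proof.
move=> nn nn'; apply: ip_inj => w; rewrite ip0l.
have nN := normal_part_normal (cr n n').
rewrite -[w](subrK (tangential w)) -/(normal_part w) ipDr.
rewrite (ip_normal_tangent nN (tangential_idem w)) addr0.
have nw := normal_part_normal w.
rewrite ipDl ipNl (form_normal (i := i0) (j := i1))// sub0r.
by rewrite (vp_ipC vp) (ip_normal_tangent nw (tangential_idem _)) oppr0.
Qed.

(** The product e_0 x e_1 is tangent and orthogonal to e_0 and e_1, hence a
    multiple of e_2. The frame need not be positively oriented, whence the sign
    lam. *)
Lemma frame_cross : exists2 lam : R, lam * lam = 1 &
  [/\ cr (e i0) (e i1) = lam *: e i2, cr (e i1) (e i2) = lam *: e i0 &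
      cr (e i2) (e i0) = lam *: e i1].
Proof.
pose lam := ip (cr (e i0) (e i1)) (e i2).
have E01 : cr (e i0) (e i1) = lam *: e i2.
  rewrite -closed_e /tangential sum3 -/lam.
  rewrite ip_crC crvv ipE oppr0 scale0r.
  by rewrite (vp_ip_cr vp) crvv ipEr scale0r !add0r.
have ll : lam * lam = 1.
  have : ip (cr (e i0) (e i1)) (cr (e i0) (e i1)) = 1.
    by rewrite ip_crC cross_twice ipDl !ipZl !orthonormal_e /=
      mulN1r mul0r addr0 opprK.
  by rewrite E01 ipZl ipZr orthonormal_e mulr1.
have lam0 : lam != 0.
  by apply: contra_eqN ll => /eqP ->; rewrite mul0r eq_sym oner_eq0.
exists lam => //; split=> //; apply: (scalerI lam0); rewrite scalerA ll scale1r.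
  rewrite -crZr -E01 (vp_crC vp (e i0)) crNr cross_twice !orthonormal_e /=.
  by rewrite scale0r addr0 scaleN1r opprK.
rewrite -crZl -E01 (vp_crC vp) cross_twice !orthonormal_e /=.
by rewrite scale0r addr0 scaleN1r opprK.
Qed.

(** On normal vectors (e_i x)^2 = -1, which gives the diagonal terms; off the
    diagonal e_i x (e_j x _) = - (e_i x e_j) x _ is antisymmetric in i and j and
    only sees the antisymmetric part of H. *)
Lemma clifford_sum (H : 'I_3 -> 'I_3 -> V) (lam : R) :
  cr (e i0) (e i1) = lam *: e i2 -> cr (e i1) (e i2) = lam *: e i0 ->
  cr (e i2) (e i0) = lam *: e i1 -> (forall i j, is_normal (H i j)) ->
  \sum_i \sum_j cr (e i) (cr (e j) (H i j)) =
  - (\sum_i H i i)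
  - lam *: (cr (e i2) (H i0 i1 - H i1 i0) + cr (e i0) (H i1 i2 - H i2 i1)
            + cr (e i1) (H i2 i0 - H i0 i2)).
Proof.
move=> E01 E12 E20 nH; rewrite !sum3 !cr_frame_sq//.
have E10 : cr (e i1) (e i0) = - (lam *: e i2) by rewrite (vp_crC vp) E01.
have E21 : cr (e i2) (e i1) = - (lam *: e i0) by rewrite (vp_crC vp) E12.
have E02 : cr (e i0) (e i2) = - (lam *: e i1) by rewrite (vp_crC vp) E20.
rewrite !cr_frame_assoc// E01 E12 E20 E10 E21 E02 !crE.
by apply: ip_inj => w; rewrite !ipE; ring.
Qed.

(** The hypotheses say that r i, as a map e_j |-> r i j, is a derivation of the
    product on the frame. For (i, j, k) cyclic the terms e_k x r_ij and
    e_j x r_ik of the left-hand side then combine, up to sign, into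
    r_i (e_j x e_k) = lam r_ii. The lemma serves both for the curvature and for
    the second fundamental form. *)
Lemma derivation_sum (r : 'I_3 -> 'I_3 -> V) (lam : R) : lam * lam = 1 ->
  lam *: r i0 i0 = cr (r i0 i1) (e i2) + cr (e i1) (r i0 i2) ->
  lam *: r i1 i1 = cr (r i1 i2) (e i0) + cr (e i2) (r i1 i0) ->
  lam *: r i2 i2 = cr (r i2 i0) (e i1) + cr (e i0) (r i2 i1) ->
  - lam *: (cr (e i2) (r i0 i1 - r i1 i0) + cr (e i0) (r i1 i2 - r i2 i1)
            + cr (e i1) (r i2 i0 - r i0 i2)) = \sum_i r i i.
Proof.
move=> ll E0 E1 E2.
have F (u : V) : u = lam *: (lam *: u) by rewrite scalerA ll scale1r.
rewrite sum3 (F (r i0 i0)) (F (r i1 i1)) (F (r i2 i2)) E0 E1 E2.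
rewrite (vp_crC vp _ (e i2)) (vp_crC vp _ (e i0)) (vp_crC vp _ (e i1)).
by apply: ip_inj => w; rewrite !crE !ipE; ring.
Qed.

(** By [cr_normal], the normal part of t contributes only a tangent vector. *)
Lemma normal_part_cr_tangent t n : is_normal n ->
  normal_part (cr t n) = \sum_k ip t (e k) *: cr (e k) n.
Proof.
move=> nn.
rewrite -[t in LHS](subrK (tangential t)) crDl normal_partD.
rewrite (cr_normal (normal_part_normal t) nn) add0r.
rewrite /tangential (big_morph (cr ^~ n) (fun x y => crDl x y n) (cr0l n)).
have -> : \sum_i cr (ip t (e i) *: e i) n = \sum_k ip t (e k) *: cr (e k) n.
  by apply: eq_bigr => k _; rewrite crZl.
rewrite normal_part_id // => i.
rewrite (big_morph (ip ^~ (e i)) (fun x y => ipDl x y (e i)) (ip0l (e i))).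
by rewrite big1 // => k _; rewrite ipZl cr_frame_normal ?mulr0.
Qed.

(** First-order part of the computation of D^2, for a fixed direction of
    differentiation: de j is the derivative of e_j, X j is nabla^perp_{e_j} psi,
    dX j is the derivative of X j, and H j the covariant Hessian. The difference
    of the two sides is the sum over j and k of
    <de j, e_k> (e_k x X_j + e_j x X_k), which vanishes by antisymmetry of the
    connection matrix. *)
Lemma dirac_derivative (de dX H : 'I_3 -> V) (X : 'I_3 -> V) :
  (forall j k, ip (de j) (e k) = - ip (de k) (e j)) ->
  (forall j, is_normal (X j)) ->
  (forall j, H j = normal_part (dX j) - \sum_k ip (de j) (e k) *: X k) ->
  normal_part (\sum_j (cr (de j) (X j) + cr (e j) (dX j))) =
  \sum_j cr (e j) (H j).
Proof.
move=> anti nX HE.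
pose c j k := ip (de j) (e k).
have cC j k : c j k = - c k j by exact: anti.
have c0 j : c j j = 0.
  have /eqP := cC j j; rewrite -addr_eq0 -mulr2n mulrn_eq0 /=.
  by move/eqP.
rewrite !sum3 !normal_partD !normal_part_cr_frame !normal_part_cr_tangent //.
rewrite !HE !sum3 -!/(c _ _) !c0 (cC i1 i0) (cC i2 i0) (cC i2 i1).
move: (c i0 i1) (c i0 i2) (c i1 i2) => c01 c02 c12.
by apply: ip_inj => w; rewrite !crE !ipE; ring.
Qed.

(** The square of the Dirac operator at a point, H being the normal Hessian. The
    last hypothesis is the Ricci equation, with r the ambient curvature and s
    the second fundamental form; both are derivations of the product. *)
Lemma weitzenbock_sum (H r s : 'I_3 -> 'I_3 -> V) (lam : R) : lam * lam = 1 ->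
  cr (e i0) (e i1) = lam *: e i2 -> cr (e i1) (e i2) = lam *: e i0 ->
  cr (e i2) (e i0) = lam *: e i1 ->
  (forall i j, is_normal (H i j)) -> (forall i j, is_normal (s i j)) ->
  lam *: r i0 i0 = cr (r i0 i1) (e i2) + cr (e i1) (r i0 i2) ->
  lam *: r i1 i1 = cr (r i1 i2) (e i0) + cr (e i2) (r i1 i0) ->
  lam *: r i2 i2 = cr (r i2 i0) (e i1) + cr (e i0) (r i2 i1) ->
  lam *: s i0 i0 = cr (s i0 i1) (e i2) + cr (e i1) (s i0 i2) ->
  lam *: s i1 i1 = cr (s i1 i2) (e i0) + cr (e i2) (s i1 i0) ->
  lam *: s i2 i2 = cr (s i2 i0) (e i1) + cr (e i0) (s i2 i1) ->
  (forall i j, H i j - H j i =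
     normal_part (r i j - r j i) - (s i j - s j i)) ->
  \sum_i \sum_j cr (e i) (cr (e j) (H i j)) =
  - (\sum_i H i i) + normal_part (\sum_i r i i) - \sum_i s i i.
Proof.
move=> ll E01 E12 E20 nH ns r0 r1 r2 s0 s1 s2 HH.
rewrite (clifford_sum E01 E12 E20 nH) !HH.
rewrite -(derivation_sum ll r0 r1 r2) -(derivation_sum ll s0 s1 s2).
rewrite normal_partZ !normal_partD !normal_part_cr_frame !normal_partD.
rewrite !normal_partN.
by apply: ip_inj => w; rewrite !crE !ipE; ring.
Qed.

End AssociativeAlgebra.

Arguments tangential {R V} ip e v.
Arguments normal_part {R V} ip e v.
Arguments is_normal {R V} ip e n.

(** * The vector product of a G2-form at a point *)

Section StandardG2.
Context {R : realType}.
Notation V := 'rV[R]_7.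

Definition entry (u : V) (n : nat) : R := u 0 (inord n).

Definition minor3 (u v w : nat -> R) (i j k : nat) : R :=
  u i * (v j * w k - v k * w j) - u j * (v i * w k - v k * w i)
  + u k * (v i * w j - v j * w i).

Definition phi0_poly (u v w : nat -> R) : R :=
  minor3 u v w 0 1 2 + minor3 u v w 0 3 4 + minor3 u v w 0 5 6
  + minor3 u v w 1 3 5 - minor3 u v w 1 4 6 - minor3 u v w 2 3 6
  - minor3 u v w 2 4 5.

Lemma dx3E i j k (u v w : V) :
  dx3 i j k u v w = minor3 (entry u) (entry v) (entry w) i j k.
Proof.
rewrite /dx3 (expand_det_row _ ord0) !big_ord_recl big_ord0 /cofactor.
rewrite !(expand_det_row _ ord0) !big_ord_recl !big_ord0 /cofactor.
rewrite !det_mx11 !mxE /= /minor3 /entry /bump /=.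
by rewrite ?(expr0, expr1, expr2, addn0, add0n, add1n); ring.
Qed.

Lemma phi0E (u v w : V) : phi0 u v w = phi0_poly (entry u) (entry v) (entry w).
Proof. by rewrite /phi0 !dx3E. Qed.

Lemma sum7 (F : 'I_7 -> R) : \sum_i F i =
  F (inord 0) + F (inord 1) + F (inord 2) + F (inord 3) + F (inord 4)
  + F (inord 5) + F (inord 6).
Proof.
rewrite !big_ord_recr big_ord0 /= add0r.
by congr (F _ + F _ + F _ + F _ + F _ + F _ + F _); apply/val_inj;
  rewrite /= inordK.
Qed.

Lemma row7P (u v : V) : (forall n, (n < 7)%N -> entry u n = entry v n) -> u = v.
Proof.
by move=> uv; apply/rowP => l; have := uv l (ltn_ord l);
  rewrite /entry inord_val.
Qed.

Definition dot (u v : V) : R := \sum_l u 0 l * v 0 l.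
Definition cross0 (u v : V) : V := \row_l phi0 u v (basis_vec R l).

Lemma dotE u v : dot u v = entry u 0 * entry v 0 + entry u 1 * entry v 1
  + entry u 2 * entry v 2 + entry u 3 * entry v 3 + entry u 4 * entry v 4
  + entry u 5 * entry v 5 + entry u 6 * entry v 6.
Proof. by rewrite /dot sum7. Qed.

Definition cross0_entry (u v : nat -> R) (n : nat) : R :=
  let b (i j : nat) := u i * v j - u j * v i in
  match n with
  | 0%N => b 1 2 + b 3 4 + b 5 6
  | 1%N => b 2 0 + b 3 5 - b 4 6
  | 2%N => b 0 1 - b 3 6 - b 4 5
  | 3%N => b 4 0 + b 5 1 - b 6 2
  | 4%N => b 0 3 - b 6 1 - b 5 2
  | 5%N => b 6 0 + b 1 3 - b 2 4
  | _ => b 0 5 - b 1 4 - b 2 3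
  end.

Lemma entry_cross0 u v n : (n < 7)%N ->
  entry (cross0 u v) n = cross0_entry (entry u) (entry v) n.
Proof.
move=> n7; rewrite {1}/entry mxE phi0E.
have -> : entry (basis_vec R (inord n)) =
    (fun m => (nat_of_ord (inord m : 'I_7) == n)%:R).
  by apply/funext => m; rewrite /entry mxE eqxx /= -val_eqE /= (inordK n7).
rewrite /phi0_poly /minor3 !inordK //.
by case: n n7 => [|[|[|[|[|[|[|n]]]]]]] //= _; ring.
Qed.

Lemma entryD u v n : entry (u + v) n = entry u n + entry v n.
Proof. by rewrite /entry mxE. Qed.
Lemma entryN u n : entry (- u) n = - entry u n.
Proof. by rewrite /entry mxE. Qed.
Lemma entryZ a u n : entry (a *: u) n = a * entry u n.
Proof. by rewrite /entry mxE. Qed.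

Lemma phi0_dot (u v w : V) : phi0 u v w = dot (cross0 u v) w.
Proof.
by rewrite phi0E dotE !entry_cross0 // /phi0_poly /minor3 /=; ring.
Qed.

(** In coordinates each axiom is a polynomial identity. *)
Lemma standard_vector_product : vector_product dot cross0.
Proof.
split.
- by move=> u v; rewrite !dotE; ring.
- by move=> a u v w; rewrite !dotE !(entryD, entryZ); ring.
- move=> u u0; rewrite lt_def sumr_ge0 ?andbT; last by move=> l _;
    rewrite -expr2 sqr_ge0.
  apply: contra u0 => /eqP/psumr_eq0P uu; apply/eqP/rowP => l; rewrite mxE.
  by apply/eqP; rewrite -sqrf_eq0 expr2 uu// => k _; rewrite -expr2 sqr_ge0.
- move=> a u v w; apply: row7P => n n7.
  rewrite entryD entryZ !entry_cross0 //.
  by case: n n7 => [|[|[|[|[|[|[|n]]]]]]] //= _; rewrite !(entryD, entryZ);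
    ring.
- move=> u v; apply: row7P => n n7.
  rewrite entryN !entry_cross0 //.
  by case: n n7 => [|[|[|[|[|[|[|n]]]]]]] //= _; ring.
- move=> u v w; rewrite !dotE !entry_cross0 //=; ring.
move=> u v w; apply: row7P => n n7.
rewrite !(entryD, entryZ) !entry_cross0// !dotE.
by case: n n7 => [|[|[|[|[|[|[|n]]]]]]] //= _; rewrite !entry_cross0 //=; ring.
Qed.

End StandardG2.

Section PointwiseG2.
Context {R : realType}.
Notation V := 'rV[R]_7.
Variables (G F : 'M[R]_7) (f : V -> V -> V -> R).
Hypothesis FG : F *m G *m F^T = 1%:M.
Hypothesis fF : forall u v w, f (u *m F) (v *m F) (w *m F) = phi0 u v w.

(** [cross_product] at a point, without the chart. *)
Definition cross_of (u v : V) : V := sharp G (\row_l f u v (basis_vec R l)).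

Lemma frame_unit : F \in unitmx.
Proof. by have := mulmx1_unit FG => -[_]; rewrite unitmx_tr. Qed.

Lemma invmx_metric : invmx G = F^T *m F.
Proof.
have uF := frame_unit.
have E : G *m (F^T *m F) = 1%:M.
  apply: (can_inj (mulKmx uF)); rewrite mulmx1 !mulmxA FG mul1mx//.
have [uG _] := mulmx1_unit E.
by rewrite -[LHS]mulmx1 -E mulKmx.
Qed.

Lemma inner_frame u v : inner G (u *m F) (v *m F) = dot u v.
Proof.
rewrite /inner trmx_mul !mulmxA -(mulmxA u) -(mulmxA u) FG mulmx1 mxE.
by apply: eq_bigr => l _; rewrite !mxE.
Qed.

Lemma cross_of_frame u v : cross_of (u *m F) (v *m F) = cross0 u v *m F.
Proof.
rewrite /cross_of /sharp invmx_metric mulmxA; congr (_ *m F).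
have -> : (\row_l f (u *m F) (v *m F) (basis_vec R l)) =
  cross0 u v *m (invmx F)^T.
  apply/rowP => l;
    rewrite [LHS]mxE -[basis_vec R l](mulmxKV frame_unit) fF phi0_dot.
  rewrite mxE; apply: eq_bigr => k _; rewrite -rowE !mxE //.
by rewrite -mulmxA -trmx_mul mulmxV ?frame_unit// trmx1 mulmx1.
Qed.

(** The frame F is an isometry that carries the standard product on R^7 to the
    product of (G, f). *)
Lemma G2_vector_product : vector_product (inner G) cross_of.
Proof.
have S := @standard_vector_product R.
have E (u : V) : u = (u *m invmx F) *m F by rewrite mulmxKV ?frame_unit.
split.
- by move=> u v; rewrite (E u) (E v) !inner_frame (vp_ipC S).
- move=> a u v w; rewrite (E u) (E v) (E w) scalemxAl -mulmxDl !inner_frame.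
  exact: vp_ip_linear S _ _ _ _.
- move=> u u0; rewrite (E u) inner_frame; apply: (vp_ip_gt0 S).
  by apply: contra_neq u0 => u0; rewrite (E u) u0 mul0mx.
- move=> a u v w; rewrite (E u) (E v) (E w) scalemxAl -mulmxDl !cross_of_frame.
  by rewrite (vp_cr_linear S) mulmxDl scalemxAl.
- by move=> u v; rewrite (E u) (E v) !cross_of_frame (vp_crC S) mulNmx.
- move=> u v w; rewrite (E u) (E v) (E w) !cross_of_frame !inner_frame.
  exact: vp_ip_cr S _ _ _.
move=> u v w; rewrite (E u) (E v) (E w) !cross_of_frame !inner_frame.
by rewrite -mulmxDl (vp_double S) !mulmxDl !scalemxAl.
Qed.

Lemma inner_cross_of u v w : inner G (cross_of u v) w = f u v w.
Proof.
have E (x : V) : x = (x *m invmx F) *m F by rewrite mulmxKV ?frame_unit.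
by rewrite (E u) (E v) (E w) cross_of_frame inner_frame fF phi0_dot.
Qed.

End PointwiseG2.

(** * Connection and curvature of a parallel G2-form *)

Section InnerLemmas.
Context {R : realType}.
Implicit Types (M N : 'M[R]_7) (u v w : 'rV[R]_7).

Lemma inner_linearl M a u v w : inner M (a *: u + v) w =
  a * inner M u w + inner M v w.
Proof. by rewrite /inner mulmxDl mulmxDl -!scalemxAl !mxE. Qed.

Lemma inner_linearr M a u v w : inner M w (a *: u + v) =
  a * inner M w u + inner M w v.
Proof. by rewrite /inner linearP mulmxDr -scalemxAr !mxE. Qed.

Lemma inner_linear_mx M N a u v : inner (a *: M + N) u v =
  a * inner M u v + inner N u v.
Proof. by rewrite /inner mulmxDr mulmxDl -scalemxAr -scalemxAl !mxE. Qed.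

Lemma inner_tr M u v : inner M^T u v = inner M v u.
Proof. by rewrite /inner -{1}(trmxK u) -!trmx_mul mulmxA [LHS]mxE. Qed.

Lemma derive_inner (m : nat) (M : 'rV[R]_m.+1 -> 'M[R]_7) x z u v :
  differentiable M x ->
  differentiable (fun y => inner (M y) u v) x /\
  'D_z (fun y => inner (M y) u v) x = inner ('D_z M x) u v.
Proof.
move=> dM.
pose L (N : 'M[R]_7) : R := inner N u v.
have LE N : L N = \sum_j (\sum_i u 0 i * N i j) * v 0 j.
  by rewrite /L /inner mxE; apply: eq_bigr => j _; rewrite !mxE.
have lin : linear L by move=> a N N'; exact: inner_linear_mx.
pose LM := GRing.isLinear.Build _ _ _ _ L lin.
pose LL : {linear 'M[R]_7 -> R} := HB.pack L LM.
have cL : continuous L.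
  move=> N; apply: differentiable_continuous.
  have -> : L = \sum_j ((\sum_i (u 0 i *: (fun N : 'M[R]_7 => N i j))) *
                        (fun=> v 0 j)).
    apply/funext => N'; rewrite LE fct_sumE; apply: eq_bigr => j _.
    by rewrite
      -[RHS]/((\sum_i (u 0 i *: (fun N : 'M[R]_7 => N i j))) N' * v 0 j)
      fct_sumE.
  apply: differentiable_sum => j; apply: differentiableM.
    apply: differentiable_sum => i; apply: differentiableZ.
    exact: differentiable_coord.
  exact: differentiable_cst.
have dL N : differentiable (LL : _ -> _) N by exact/linear_differentiable.
have dLM : differentiable ((LL : _ -> _) \o M) x by exact: differentiable_comp.
split; first exact: dLM.
rewrite -[LHS]/('D_z ((LL : _ -> _) \o M) x) (deriveE _ dLM) diff_comp //.
by rewrite (diff_lin _ (cL : continuous LL)) /= (deriveE _ dM).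
Qed.

End InnerLemmas.

(** What the hypotheses on M say in one chart; the whole identity is proved
    there. *)
Record local_G2 (R : realType) (U : set 'rV[R]_7) (G : 'rV[R]_7 -> 'M[R]_7)
    (f : 'rV[R]_7 -> 'rV[R]_7 -> 'rV[R]_7 -> 'rV[R]_7 -> R) : Prop := LocalG2 {
  local_open : open U;
  local_metric_smooth : smooth_on U G;
  local_metric_sym : forall x, U x -> (G x)^T = G x;
  local_form_smooth : forall u v w, smooth_on U (fun x => f x u v w : R);
  local_form_G2 : forall x, U x -> exists F : 'M[R]_7,
    F *m G x *m F^T = 1%:M /\
    forall u v w, f x (u *m F) (v *m F) (w *m F) = phi0 u v w;
  local_form_parallel : forall x z u v w, U x ->
    'D_z (fun y => f y u v w : R) x - f x (christoffel G x z u) v w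
    - f x u (christoffel G x z v) w - f x u v (christoffel G x z w) = 0
}.

Section Connection.
Context {R : realType}.
Notation V := 'rV[R]_7.
Variables (U : set V) (G : V -> 'M[R]_7) (f : V -> V -> V -> V -> R).
Hypothesis hL : local_G2 U G f.

Let oU : open U := local_open hL.
Let sG : smooth_on U G := local_metric_smooth hL.
Let Gsym x : U x -> (G x)^T = G x := @local_metric_sym _ _ _ _ hL x.
Let sf u v w : smooth_on U (fun x => f x u v w : R) :=
  local_form_smooth hL u v w.
Let fG2 x := @local_form_G2 _ _ _ _ hL x.
Let fpar x z u v w := @local_form_parallel _ _ _ _ hL x z u v w.

Notation Gam := (christoffel G).
Local Notation K x := (cross_of (G x) (f x)).

Lemma vp_at x : U x -> vector_product (inner (G x)) (cross_of (G x) (f x)).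
Proof. by move=> /fG2[F [FG fF]]; exact: G2_vector_product FG fF. Qed.

Lemma inner_cross x u v w : U x -> inner (G x) (K x u v) w = f x u v w.
Proof. by move=> /fG2[F [FG fF]]; exact: inner_cross_of FG fF _ _ _. Qed.

Lemma metric_unit x : U x -> G x \in unitmx.
Proof.
move=> /fG2[F [FG _]]; have [] := mulmx1_unit FG.
by rewrite unitmx_mul => /andP[].
Qed.

Lemma differentiable_metric x : U x -> differentiable G x.
Proof. exact: smooth_on_differentiable. Qed.

Lemma smooth_mx_metric : smooth_mx U G.
Proof. by move=> i j; exact: smooth_on_entry. Qed.

Lemma smooth_inner (M : V -> 'M[R]_7) u v : smooth_mx U M ->
  smooth_on U (fun x => inner (M x) u v).
Proof.
move=> sM.
have := smooth_mx_mul oU (smooth_mx_mul oU (smooth_mx_cst U u) sM)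
  (smooth_mx_cst U v^T).
by move/(_ 0 0).
Qed.

Lemma smooth_mx_christoffel u v : smooth_mx U (fun x => Gam x u v).
Proof.
apply: smooth_mx_mul => //; last first.
  by apply: smooth_mx_inv => //; [exact: metric_unit|exact: smooth_mx_metric].
apply: smooth_mx_scale => //; first exact: smooth_on_cst.
apply: smooth_mx_row => // l.
have sDG w a b := smooth_inner a b (smooth_mx_derive oU w smooth_mx_metric).
apply: smooth_on_add => //; first by apply: smooth_on_add.
apply: (smooth_on_eq oU _
  (smooth_on_mul oU (smooth_on_cst U (-1 : R)) (sDG _ _ _))).
by move=> x _; rewrite mulN1r.
Qed.

Lemma smooth_mx_cross u v : smooth_mx U (fun x => K x u v).
Proof.
apply: smooth_mx_mul => //; last first.
  by apply: smooth_mx_inv => //; [exact: metric_unit|exact: smooth_mx_metric].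
by apply: smooth_mx_row => // l.
Qed.

Lemma smooth_christoffel u v : smooth_on U (fun x => Gam x u v).
Proof. by apply: smooth_on_mx => //; exact: smooth_mx_christoffel. Qed.

Lemma smooth_cross u v : smooth_on U (fun x => K x u v).
Proof. by apply: smooth_on_mx => //; exact: smooth_mx_cross. Qed.

Lemma derive_metric_linear x a u v : U x ->
  'D_(a *: u + v) G x = a *: 'D_u G x + 'D_v G x.
Proof. by move=> Ux; rewrite !(deriveE _ (differentiable_metric Ux)) linearP.
Qed.

Lemma inner_derive_sym x z u v : U x ->
  inner ('D_z G x) u v = inner ('D_z G x) v u.
Proof.
move=> Ux; rewrite -!(derive_inner z _ _ (differentiable_metric Ux)).2.
apply: near_eq_derive; apply: near_open_eq oU Ux _ => y Uy.
by rewrite -[in LHS](Gsym Uy) inner_tr.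
Qed.

Lemma inner_christoffel x u v w : U x -> inner (G x) (Gam x u v) w =
  2^-1 * (inner ('D_u G x) v w + inner ('D_v G x) u w - inner ('D_w G x) u v).
Proof.
move=> Ux.
pose q (w : V) : R^o :=
  2^-1 * (inner ('D_u G x) v w + inner ('D_v G x) u w - inner ('D_w G x) u v).
rewrite -[RHS]/(q w) (linear_row (L := q)); last first.
  move=> a y z; rewrite /q derive_metric_linear // inner_linear_mx.
  move: ('D_u G x) ('D_v G x) ('D_y G x) ('D_z G x) => A B C D.
  rewrite (inner_linearr A) (inner_linearr B).
  by rewrite -[a *: (_ : R^o)]/(a * _); ring.
rewrite /christoffel /sharp /inner mulmxKV ?metric_unit // mxE.
by apply: eq_bigr => l _;
  rewrite mxE [(\row__ _) _ _]mxE [w^T _ _]mxE [LHS]mulrC.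
Qed.

(** The Koszul formula, with the first derivatives of the metric presented as an
    abstract trilinear map q: the consequences drawn from it are then plain
    algebra in the values of q. *)
Lemma koszul x : U x -> exists q : V -> V -> V -> R,
  [/\ forall a b c, inner ('D_a G x) b c = q a b c,
      forall a b c, q a b c = q a c b,
      forall k a a' b c, q (k *: a + a') b c = k * q a b c + q a' b c,
      forall k a b b' c, q a (k *: b + b') c = k * q a b c + q a b' c &
      forall u v w, inner (G x) (Gam x u v) w =
        2^-1 * (q u v w + q v u w - q w u v)].
Proof.
move=> Ux; exists (fun a b c => inner ('D_a G x) b c); split=> //.
- by move=> a b c; exact: inner_derive_sym.
- by move=> k a a' b c; rewrite derive_metric_linear // inner_linear_mx.
- by move=> k a b b' c; rewrite inner_linearl.
by move=> u v w; exact: inner_christoffel.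
Qed.

Lemma metric_compat x z u v : U x -> inner ('D_z G x) u v =
  inner (G x) (Gam x z u) v + inner (G x) u (Gam x z v).
Proof.
move=> Ux; have [q [-> qC _ _ qE]] := koszul Ux.
rewrite [X in _ = _ + X](vp_ipC (vp_at Ux)) !qE
  (qC z v u) (qC u z v) (qC v z u).
by field.
Qed.

Lemma christoffelC x u v : U x -> Gam x u v = Gam x v u.
Proof.
move=> Ux; have [q [_ qC _ _ qE]] := koszul Ux.
by apply: (ip_inj (vp_at Ux)) => w; rewrite !qE (qC w v u); ring.
Qed.

Lemma christoffel_linearr x a u v w : U x ->
  Gam x w (a *: u + v) = a *: Gam x w u + Gam x w v.
Proof.
move=> Ux; have [q [_ qC ql1 ql2 qE]] := koszul Ux.
have ql3 k b c c' d : q b d (k *: c + c') = k * q b d c + q b d c'.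
  by rewrite !(qC b d) ql2.
apply: (ip_inj (vp_at Ux)) => y; rewrite inner_linearl !qE ql1 ql2 ql3.
by ring.
Qed.

Lemma christoffel_linearl x a u v w : U x ->
  Gam x (a *: u + v) w = a *: Gam x u w + Gam x v w.
Proof. by move=> Ux; rewrite !(christoffelC _ w)// christoffel_linearr. Qed.

Lemma christoffelDr x u v w : U x -> Gam x w (u + v) = Gam x w u + Gam x w v.
Proof. by move=> Ux; rewrite -[u in LHS]scale1r christoffel_linearr// scale1r.
Qed.

Lemma christoffel0r x w : U x -> Gam x w 0 = 0.
Proof.
move=> Ux; have := christoffel_linearr (-1) 0 0 w Ux.
by rewrite scaleN1r oppr0 addr0 scaleN1r addNr.
Qed.

Lemma christoffelNr x u w : U x -> Gam x w (- u) = - Gam x w u.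
Proof.
move=> Ux; have := christoffel_linearr (-1) u 0 w Ux.
by rewrite !scaleN1r addr0 christoffel0r// addr0.
Qed.

(** The product is parallel: differentiate <u x v, w> = phi(u, v, w), where the
    form is parallel and the connection is metric. *)
Lemma derive_cross x z u v : U x -> 'D_z (fun y => K y u v) x =
  K x (Gam x z u) v + K x u (Gam x z v) - Gam x z (K x u v).
Proof.
move=> Ux; apply: (ip_inj (vp_at Ux)) => w.
have dK := smooth_on_differentiable (smooth_cross u v) Ux.
have [_ /(_ z)] := derive_bilinear_form oU Ux
  (fun y c a b d _ => inner_linearl (G y) c a b d)
  (fun y c a b d _ => inner_linearr (G y) c a b d)
  (fun a b => (derive_inner z a b (differentiable_metric Ux)).1) dK
    (differentiable_cst w x).
have E : \forall y \near x, f y u v w = inner (G y) (K y u v) w.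
  by apply: near_open_eq oU Ux _ => y Uy; rewrite inner_cross.
rewrite -(near_eq_derive z E) derive_cst
  (derive_inner z _ _ (differentiable_metric Ux)).2.
rewrite metric_compat // (ip0r (vp_at Ux)) addr0 => Dz.
have := fpar z u v w Ux; rewrite -!inner_cross // Dz => /eqP;
  rewrite subr_eq0 => /eqP.
rewrite !(ipDl (vp_at Ux)) (ipNl (vp_at Ux)) => H.
lra.
Qed.

(** R(w, z)u for constant fields w, z, u; the fields w and z commute. *)
Definition curv x w z u : V := 'D_w (fun y => Gam y z u) x
  - 'D_z (fun y => Gam y w u) x + Gam x w (Gam x z u) - Gam x z (Gam x w u).

Lemma curvature_tensorE x w z u : U x ->
  curvature_tensor G x w z u = curv x w z u.
Proof.
move=> Ux; rewrite /curvature_tensor /curvature_fields.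
have E a : (fun y => nabla G a (fun=> u) y) = (fun y => Gam y a u).
  by apply/funext => y; rewrite /nabla derive_cst add0r.
have E2 a b : nabla G a (fun y => nabla G b (fun=> u) y) x =
    'D_a (fun y => Gam y b u) x + Gam x a (Gam x b u) by rewrite (E b).
have E3 : nabla G (lie_bracket (fun=> w) (fun=> z) x) (fun=> u) x = 0.
  have -> : lie_bracket (fun=> w) (fun=> z) x = 0.
    by rewrite /lie_bracket (derive_cst z x w) (derive_cst w x z) subrr.
  by rewrite /nabla derive_cst add0r (christoffelC 0 u Ux) christoffel0r.
rewrite (E2 w z) (E2 z w) E3 subr0 /curv.
move: ('D_w (fun y => Gam y z u) x) ('D_z (fun y => Gam y w u) x) => a b.
by rewrite opprD addrACA addrA.
Qed.

(** The first Bianchi identity, a consequence of the symmetry of the Christoffel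
    symbols, in the form in which it meets [weitzenbock_sum]. *)
Lemma curv_bianchi x w z u : U x -> curv x w z u = curv x w u z - curv x z u w.
Proof.
move=> Ux; rewrite /curv.
have E a b c : 'D_a (fun y => Gam y b c) x = 'D_a (fun y => Gam y c b) x.
  apply: near_eq_derive; apply: near_open_eq oU Ux _ => y Uy.
  exact: christoffelC.
rewrite (E w u z) (E z u w) (E u w z).
rewrite (christoffelC u z Ux) (christoffelC u w Ux) (christoffelC w z Ux).
have key (a b c d e h : V) :
    a - b + d - e = (a - c + d - h) - (b - c + e - h).
  by apply/rowP => i; rewrite !mxE; ring.
exact: key.
Qed.

Lemma cross_linearl y c u v w : U y -> K y (c *: u + v) w =
  c *: K y u w + K y v w.
Proof. by move=> Uy; exact: vp_cr_linear (vp_at Uy) _ _ _ _. Qed.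

Lemma cross_linearr y c u v w : U y -> K y w (c *: u + v) =
  c *: K y w u + K y w v.
Proof. by move=> Uy; rewrite (crDr (vp_at Uy)) (crZr (vp_at Uy)). Qed.

Lemma derive2_cross x w z u v : U x ->
  'D_w ('D_z (fun y => K y u v)) x =
    K x ('D_w (fun y => Gam y z u) x) v + K x u ('D_w (fun y => Gam y z v) x)
    - 'D_w (fun y => Gam y z (K x u v)) x
    + (K x (Gam x w (Gam x z u)) v + K x (Gam x z u) (Gam x w v)
       - Gam x w (K x (Gam x z u) v))
    + (K x (Gam x w u) (Gam x z v) + K x u (Gam x w (Gam x z v))
       - Gam x w (K x u (Gam x z v)))
    - Gam x z (K x (Gam x w u) v + K x u (Gam x w v) - Gam x w (K x u v)).
Proof.
move=> Ux.
have E : \forall y \near x, 'D_z (fun y => K y u v) y =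
    K y (Gam y z u) v + K y u (Gam y z v) - Gam y z (K y u v).
  by apply: near_open_eq oU Ux _ => y Uy; exact: derive_cross.
rewrite (near_eq_derive w E).
have dK a b := smooth_on_differentiable (smooth_cross a b) Ux.
have dGam a b := smooth_on_differentiable (smooth_christoffel a b) Ux.
have BK := derive_bilinear (B := fun y => K y) oU Ux
  cross_linearl cross_linearr dK.
have [d1 /(_ w)] := BK _ _ (dGam z u) (differentiable_cst v x).
rewrite (derive_cross w (Gam x z u) v Ux) (derive_cst v x w) (cr0r (vp_at Ux))
  addr0 => D1.
have [d2 /(_ w)] := BK _ _ (differentiable_cst u x) (dGam z v).
rewrite (derive_cross w u (Gam x z v) Ux) (derive_cst u x w) (cr0l (vp_at Ux))
  addr0 => D2.
have [d3 /(_ w)] := derive_linear_family oU Ux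
  (fun y c a b Uy => christoffel_linearr c a b z Uy) (dGam z) (dK u v).
rewrite (derive_cross w u v Ux) => D3.
have key (F1 F2 F3 : V -> V) : differentiable F1 x -> differentiable F2 x ->
    differentiable F3 x -> 'D_w (fun y => F1 y + F2 y - F3 y) x =
    'D_w F1 x + 'D_w F2 x - 'D_w F3 x.
  move=> e1 e2 e3; rewrite (deriveB (f := fun y => F1 y + F2 y)).
  - by rewrite deriveD //; exact: diff_derivable.
  - by apply/diff_derivable/differentiableD.
  - exact: diff_derivable.
rewrite (key _ _ _ d1 d2 d3) D1 D2 D3.
have key2 (a b c p1 p2 p3 : V) :
    p1 + a + (p2 + b) - (c + p3) = a + b - c + p1 + p2 - p3.
  by apply/rowP => i; rewrite !mxE; ring.
exact: key2.
Qed.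

(** Second derivatives of the product commute, so antisymmetrizing
    [derive2_cross] in w and z makes the curvature a derivation of the
    product. *)
Lemma curv_cross x w z u v : U x ->
  curv x w z (K x u v) = K x (curv x w z u) v + K x u (curv x w z v).
Proof.
move=> Ux.
have := etrans (esym (derive2_cross w z u v Ux))
  (etrans (derive_comm_row w z oU Ux (smooth_cross u v))
          (derive2_cross z w u v Ux)).
rewrite /curv.
rewrite !(christoffelDr _ _ _ Ux) !(christoffelNr _ _ Ux).
rewrite !(crDl (vp_at Ux)) !(crNl (vp_at Ux)) !(crDr (vp_at Ux))
  !(crNr (vp_at Ux)).
have key (a1 a2 b1 b2 c1 c2 k1 k2 l1 l2 m1 m2 g1 g2 n1 n2 h1 h2 : V) :
    a1 + b1 - c1 + (k1 + m1 - g1) + (m2 + k2 - g2) - (n1 + n2 - h1) =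
    a2 + b2 - c2 + (l1 + m2 - n1) + (m1 + l2 - n2) - (g1 + g2 - h2) ->
    c1 - c2 + h2 - h1 = a1 - a2 + k1 - l1 + (b1 - b2 + k2 - l2).
  move=> /rowP E; apply/rowP => i; have := E i; rewrite !mxE; lra.
exact: key.
Qed.

End Connection.

Section CurvScale.
Context {R : realType}.
Notation V := 'rV[R]_7.
Variables (U : set V) (G : V -> 'M[R]_7) (f : V -> V -> V -> V -> R).
Hypothesis hL : local_G2 U G f.

Lemma christoffelZr x a u w : U x ->
  christoffel G x w (a *: u) = a *: christoffel G x w u.
Proof.
move=> Ux; have := christoffel_linearr hL a u 0 w Ux.
by rewrite !addr0 (christoffel0r hL _ Ux) addr0.
Qed.

Lemma curvZ x w z a u : U x -> curv G x w z (a *: u) = a *: curv G x w z u.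
Proof.
move=> Ux.
have E p q : 'D_p (fun y => christoffel G y q (a *: u)) x =
    a *: 'D_p (fun y => christoffel G y q u) x.
  have dg := smooth_on_differentiable (smooth_christoffel hL q u) Ux.
  apply: etrans (deriveZ a (diff_derivable (v := p) dg)).
  apply: near_eq_derive; apply: near_open_eq (local_open hL) Ux _ => y Uy.
  exact: christoffelZr.
rewrite /curv (E w z) (E z w) !(christoffelZr _ _ _ Ux).
by rewrite !scalerBr !scalerDr scalerN.
Qed.

End CurvScale.

(** * Covariant derivatives along the slice *)

Section SliceCalculus.
Context {R : realType}.
Notation V := 'rV[R]_7.
Notation T := 'rV[R]_3.
Notation P := (slice_mx R).
Variables (U : set V) (G : V -> 'M[R]_7) (f : V -> V -> V -> V -> R).
Hypothesis hL : local_G2 U G f.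
Notation Gam := (christoffel G).
Local Notation K x := (cross_of (G x) (f x)).

(** A section of TM along Y is only differentiable along Y, so that it is
    studied as a function of the parameter t of the point t *m P of the
    slice. *)
Definition slice_preimage (U : set V) : set T := [set t | U (t *m P)].
Notation W := (slice_preimage U).

Lemma slice_mx_mul_tr : P *m P^T = 1%:M.
Proof. by rewrite /slice_mx tr_pid_mx mul_pid_mx /= pid_mx_1. Qed.

Lemma sliceK (v : V) : (v <= P)%MS -> v *m P^T *m P = v.
Proof.
by move=> /submxP[D ->]; rewrite -(mulmxA D) slice_mx_mul_tr mulmx1.
Qed.

Lemma open_slice_preimage (O : set V) : open O -> open (slice_preimage O).
Proof. exact: open_comp_linear. Qed.

Let oW : open W := open_slice_preimage (local_open hL).

(** The pullback of the Levi-Civita connection by the parametrization of the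
    slice. *)
Definition cov (a : T -> V) (t s : T) : V :=
  'D_s a t + Gam (t *m P) (s *m P) (a t).

Lemma nabla_slice (s : V -> V) (t v : T) :
  nabla G (v *m P) s (t *m P) = cov (fun r => s (r *m P)) t v.
Proof. by rewrite /cov derive_comp_linear. Qed.

Lemma cov_near (O : set T) (a b : T -> V) t v : open O -> O t ->
  (forall r, O r -> a r = b r) -> cov a t v = cov b t v.
Proof.
move=> oO Ot ab; rewrite /cov (ab t Ot); congr (_ + _).
by apply: near_eq_derive; exact: near_open_eq oO Ot ab.
Qed.

Lemma covD a b t v : W t -> differentiable a t -> differentiable b t ->
  cov (fun r => a r + b r) t v = cov a t v + cov b t v.
Proof.
move=> Wt da db; rewrite /cov (christoffelDr hL _ _ _ Wt).
have -> : 'D_v (fun r => a r + b r) t = 'D_v a t + 'D_v b t.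
  by apply: deriveD; exact: diff_derivable.
exact: addrACA.
Qed.

Lemma covN a t v : W t -> differentiable a t ->
  cov (fun r => - a r) t v = - cov a t v.
Proof.
move=> Wt da; rewrite /cov (christoffelNr hL _ _ Wt) opprD; congr (_ + _).
by apply: deriveN; exact: diff_derivable.
Qed.

Lemma cov_sum n (a : 'I_n -> T -> V) t v : W t ->
  (forall i, differentiable (a i) t) ->
  cov (fun r => \sum_i a i r) t v = \sum_i cov (a i) t v.
Proof.
move=> Wt da; rewrite /cov big_split /=; congr (_ + _).
  have -> : (fun r => \sum_i a i r) = \sum_i a i.
    by apply/funext => r; rewrite fct_sumE.
  by apply: derive_sum => i; exact: diff_derivable.
apply: (big_morph (Gam (t *m P) (v *m P))).
  by move=> y z; exact: (christoffelDr hL y z _ Wt).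
exact: (christoffel0r hL _ Wt).
Qed.

Lemma cov_cross a b t : W t -> differentiable a t -> differentiable b t ->
  differentiable (fun r => K (r *m P) (a r) (b r)) t /\
  forall v, cov (fun r => K (r *m P) (a r) (b r)) t v =
    K (t *m P) (cov a t v) (b t) + K (t *m P) (a t) (cov b t v).
Proof.
move=> Wt da db.
have dK u v : differentiable (fun r : T => K (r *m P) u v) t.
  exact: (smooth_on_differentiable
    (smooth_on_comp_linear P (smooth_cross hL u v)) Wt).
have [d D] := derive_bilinear (B := fun r => K (r *m P)) oW Wt
  (fun r c u v w Wr => cross_linearl hL c u v w Wr)
  (fun r c u v w Wr => cross_linearr hL c u v w Wr) dK da db.
split=> // v; rewrite /cov D.
rewrite (derive_comp_linear P (fun y => K y (a t) (b t)) t v)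
  (derive_cross hL _ _ _ Wt).
have vp := vp_at hL Wt.
rewrite (crDl vp) (crDr vp).
have key (k1 k2 g d1 d2 : V) :
    k1 + k2 - g + d1 + d2 + g = d1 + k1 + (d2 + k2).
  by apply/rowP => i; rewrite !mxE; ring.
exact: key.
Qed.

Lemma cov_inner a b t v : W t -> differentiable a t -> differentiable b t ->
  'D_v (fun r => inner (G (r *m P)) (a r) (b r)) t =
  inner (G (t *m P)) (cov a t v) (b t) + inner (G (t *m P)) (a t) (cov b t v).
Proof.
move=> Wt da db.
have dGP : differentiable (fun r : T => G (r *m P)) t.
  exact: (smooth_on_differentiable
    (smooth_on_comp_linear P (local_metric_smooth hL)) Wt).
have [_ ->] := derive_bilinear_form (B := fun r => inner (G (r *m P))) oW Wt
  (fun r c u w z _ => inner_linearl (G (r *m P)) c u w z)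
  (fun r c u w z _ => inner_linearr (G (r *m P)) c u w z)
  (fun u w => (derive_inner v u w dGP).1) da db.
rewrite (derive_comp_linear P (fun y => inner (G y) (a t) (b t)) t v).
rewrite (derive_inner _ _ _ (differentiable_metric hL Wt)).2
  (metric_compat hL _ _ _ Wt) /cov.
have vp := vp_at hL Wt.
rewrite (ipDl vp) (ipDr vp).
have key (k1 k2 d1 d2 : R) : k1 + k2 + d1 + d2 = d1 + k1 + (d2 + k2) by ring.
exact: key.
Qed.

(** The flat term 'D_v c t *m P is tangent to the slice: modulo tangent vectors,
    the derivative of a tangent field is the Christoffel symbol alone. *)
Lemma cov_tangent (c : T -> T) t v : differentiable c t ->
  differentiable (fun r => c r *m P) t /\
  cov (fun r => c r *m P) t v =
    'D_v c t *m P + Gam (t *m P) (v *m P) (c t *m P).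
Proof.
move=> dc.
have [|||d D] :=
  @derive_linear_family R 2 2 6 setT (fun _ u => u *m P) c t openT I.
- by move=> y k u w _; rewrite mulmxDl scalemxAl.
- by move=> u; exact: differentiable_cst.
- exact: dc.
by split=> //; rewrite /cov D derive_cst add0r.
Qed.

Section MovingDirection.
Variable psi : T -> V.
Hypothesis spsi : smooth_on W psi.

Lemma cov_linear t c u v : W t ->
  cov psi t (c *: u + v) = c *: cov psi t u + cov psi t v.
Proof.
move=> Wt; rewrite /cov mulmxDl -scalemxAl (christoffel_linearl hL _ _ _ _ Wt).
have dpsi := smooth_on_differentiable spsi Wt.
rewrite !(deriveE _ dpsi) linearP.
move: ('d psi t u) ('d psi t v) => a b.
by rewrite scalerDr addrACA.
Qed.

Lemma derive_cov_cst t u : W t -> differentiable (fun r => cov psi r u) t /\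
  forall v, 'D_v (fun r => cov psi r u) t =
    'D_v ('D_u psi) t
    + 'D_(v *m P) (fun y => Gam y (u *m P) (psi t)) (t *m P)
    + Gam (t *m P) (u *m P) ('D_v psi t).
Proof.
move=> Wt.
have dpsi := smooth_on_differentiable spsi Wt.
have dDpsi := smooth_on_differentiable (smooth_on_derive u spsi) Wt.
have dGam w : differentiable (fun r : T => Gam (r *m P) (u *m P) w) t.
  exact: (smooth_on_differentiable
    (smooth_on_comp_linear P (smooth_christoffel hL (u *m P) w)) Wt).
have [d D] := derive_linear_family (L := fun r => Gam (r *m P) (u *m P)) oW Wt
  (fun r c a b Wr => christoffel_linearr hL c a b (u *m P) Wr) dGam dpsi.
split; first exact: differentiableD.
move=> v.
have -> : 'D_v (fun r => cov psi r u) t = 'D_v ('D_u psi) t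
    + 'D_v (fun r => Gam (r *m P) (u *m P) (psi r)) t.
  by apply: deriveD; exact: diff_derivable.
rewrite D (derive_comp_linear P (fun y => Gam y (u *m P) (psi t)) t v).
exact: addrA.
Qed.

(** Bilinearity of nabla_eta psi in eta and the differentiated connection: the
    derivative of the direction contributes nabla_{d eta} psi. *)
Lemma derive_cov_moving (eta : T -> T) t : W t -> differentiable eta t ->
  differentiable (fun r => cov psi r (eta r)) t /\
  forall v, cov (fun r => cov psi r (eta r)) t v =
    cov (fun r => cov psi r (eta t)) t v + cov psi t ('D_v eta t).
Proof.
move=> Wt deta.
have [d D] := derive_linear_family (L := fun r => cov psi r) oW Wt
  (fun r c a b Wr => cov_linear c a b Wr)
  (fun u => (derive_cov_cst u Wt).1) deta.
split=> // v; rewrite {1}/cov D -addrA (addrC (cov psi t _)) addrA //.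
Qed.

(** The pulled-back connection has the curvature of M in tangent directions; the
    second derivatives of psi cancel by [derive_comm_row]. *)
Lemma cov_curvature t u v : W t ->
  cov (fun r => cov psi r v) t u - cov (fun r => cov psi r u) t v =
  curv G (t *m P) (u *m P) (v *m P) (psi t).
Proof.
move=> Wt.
have E a b : cov (fun r => cov psi r b) t a =
    'D_a ('D_b psi) t + 'D_(a *m P) (fun y => Gam y (b *m P) (psi t)) (t *m P)
    + Gam (t *m P) (b *m P) ('D_a psi t)
    + (Gam (t *m P) (a *m P) ('D_b psi t)
       + Gam (t *m P) (a *m P) (Gam (t *m P) (b *m P) (psi t))).
  by rewrite {1}/cov (derive_cov_cst b Wt).2 (christoffelDr hL _ _ _ Wt).
apply: etrans (congr2 (fun x y => x - y) (E u v) (E v u)) _.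
have S := derive_comm_row u v oW Wt spsi.
rewrite S /curv.
have key (d a1 a2 g1 g2 h1 h2 : V) :
    d + a1 + g1 + (g2 + h1) - (d + a2 + g2 + (g1 + h2)) = a1 - a2 + h1 - h2.
  by apply/rowP => i; rewrite !mxE; ring.
exact: key.
Qed.

Lemma cov_commutator (eta zeta : T -> T) t : W t ->
  differentiable eta t -> differentiable zeta t ->
  cov (fun r => cov psi r (zeta r)) t (eta t)
    - cov (fun r => cov psi r (eta r)) t (zeta t) =
  curv G (t *m P) (eta t *m P) (zeta t *m P) (psi t)
    + cov psi t ('D_(eta t) zeta t - 'D_(zeta t) eta t).
Proof.
move=> Wt deta dzeta.
rewrite (derive_cov_moving Wt dzeta).2 (derive_cov_moving Wt deta).2.
rewrite -(cov_curvature _ _ Wt).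
have -> : cov psi t ('D_(eta t) zeta t - 'D_(zeta t) eta t) =
    cov psi t ('D_(eta t) zeta t) - cov psi t ('D_(zeta t) eta t).
  by rewrite addrC -scaleN1r (cov_linear _ _ _ Wt) scaleN1r addrC.
have key (a b c d : V) : a + b - (c + d) = a - c + (b - d).
  by apply/rowP => i; rewrite !mxE; ring.
exact: key.
Qed.

End MovingDirection.

Lemma torsion_free (eta zeta : T -> T) t : W t ->
  differentiable eta t -> differentiable zeta t ->
  cov (fun r => zeta r *m P) t (eta t) - cov (fun r => eta r *m P) t (zeta t) =
  ('D_(eta t) zeta t - 'D_(zeta t) eta t) *m P.
Proof.
move=> Wt deta dzeta.
rewrite (cov_tangent (eta t) dzeta).2 (cov_tangent (zeta t) deta).2.
rewrite (christoffelC hL (zeta t *m P) _ Wt) mulmxBl.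
have key (a b c : V) : a + c - (b + c) = a - b.
  by apply/rowP => i; rewrite !mxE; ring.
exact: key.
Qed.

End SliceCalculus.

(** * Tangential and normal projections *)

Section Projections.
Context {R : realType}.
Notation V := 'rV[R]_7.
Notation T := 'rV[R]_3.
Notation P := (slice_mx R).
Variables (U : set V) (G : V -> 'M[R]_7) (f : V -> V -> V -> V -> R).
Hypothesis hL : local_G2 U G f.

Definition gram (y : V) : 'M[R]_3 := P *m G y *m P^T.
(** By [proj_tangentE], it computes the slice coordinates of the tangential
    projection; these are needed because only a function with values in R^3 can
    show that the derivative of a tangent field has a tangent flat part. *)
Definition slice_coord_mx (y : V) : 'M[R]_(7, 3) :=
  G y *m P^T *m invmx (gram y).

Lemma inner_gram y (a b : T) :
  inner (G y) (a *m P) (b *m P) = (a *m gram y *m b^T) 0 0.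
Proof. by rewrite /inner /gram trmx_mul !mulmxA. Qed.

(** The metric is positive definite on the slice. *)
Lemma gram_unit y : U y -> gram y \in unitmx.
Proof.
move=> Uy; rewrite -row_free_unit -kermx_eq0; apply/rowV0P => v /sub_kermxP vA.
have vP0 : v *m P = 0.
  apply/eqP/negPn/negP => /(vp_ip_gt0 (vp_at hL Uy)).
  by rewrite inner_gram vA mul0mx mxE ltxx.
by rewrite -[v]mulmx1 -slice_mx_mul_tr mulmxA vP0 mul0mx.
Qed.

Lemma proj_tangentE y v : proj_tangent (G y) v = v *m slice_coord_mx y *m P.
Proof. by rewrite /proj_tangent /slice_coord_mx /gram !mulmxA. Qed.

Lemma inner_proj_normal y v (a : T) : U y ->
  inner (G y) (v - proj_tangent (G y) v) (a *m P) = 0.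
Proof.
move=> Uy.
have E : v *m slice_coord_mx y *m gram y = v *m G y *m P^T.
  by rewrite /slice_coord_mx mulmxA mulmxKV ?gram_unit// mulmxA.
rewrite proj_tangentE (ipDl (vp_at hL Uy)) (ipNl (vp_at hL Uy)) inner_gram E.
by rewrite /inner trmx_mul mulmxA subrr.
Qed.

Lemma smooth_slice_coord_mx : smooth_mx U slice_coord_mx.
Proof.
have oU := local_open hL.
have sG := smooth_mx_metric hL.
apply: smooth_mx_mul => //.
  by apply: smooth_mx_mul => //; exact: smooth_mx_cst.
apply: smooth_mx_inv => //; first exact: gram_unit.
apply: smooth_mx_mul => //; last exact: smooth_mx_cst.
by apply: smooth_mx_mul => //; exact: smooth_mx_cst.
Qed.

Section Frame.
Variables (y : V) (e : 'I_3 -> V).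
Hypothesis Uy : U y.
Hypothesis eP : forall i, (e i <= P)%MS.
Hypothesis orth : forall i j, inner (G y) (e i) (e j) = (i == j)%:R.

(** The matrix E of the frame in slice coordinates satisfies
    E (gram y) E^T = 1, so it is invertible and the frame is a basis of TY. *)
Lemma frame_complete v : (v <= P)%MS -> tangential (inner (G y)) e v = v.
Proof.
move=> vP; have vp := vp_at hL Uy.
pose E : 'M[R]_3 := \matrix_i (e i *m P^T).
have rE i : row i E *m P = e i by rewrite rowK sliceK.
have EE : E *m gram y *m E^T = 1%:M.
  apply/matrixP => i j; rewrite [RHS]mxE -orth -!rE inner_gram.
  rewrite [LHS]mxE [RHS]mxE; apply: eq_bigr => k _.
  by rewrite -row_mul [row _ _ _ _]mxE !mxE.
have uE : E \in unitmx by have [] := mulmx1_unit EE;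
  rewrite unitmx_mul => /andP[].
have -> : v = \sum_i (v *m P^T *m invmx E) 0 i *: e i.
  apply: (@etrans _ _ (v *m P^T *m invmx E *m E *m P)).
    by rewrite mulmxKV // sliceK.
  rewrite (mulmx_sum_row _ E) mulmx_suml.
  by apply: eq_bigr => i _; rewrite -scalemxAl rE.
have t0 : tangential (inner (G y)) e 0 = 0.
  by apply: tangential_normal => i; rewrite (ip0l vp).
rewrite (big_morph (tangential (inner (G y)) e) (tangentialD vp e) t0).
by apply: eq_bigr => i _; rewrite (tangentialZ vp) (tangential_frame orth).
Qed.

Lemma proj_tangent_frame v :
  proj_tangent (G y) v = tangential (inner (G y)) e v.
Proof.
have vp := vp_at hL Uy.
rewrite -[v in RHS](subrK (proj_tangent (G y) v)) (tangentialD vp).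
rewrite tangential_normal ?add0r; last first.
  by move=> i; rewrite -(sliceK (eP i)) inner_proj_normal.
by rewrite frame_complete // proj_tangentE submxMl.
Qed.

Lemma proj_normal_frame v : proj_normal (G y) v = normal_part (inner (G y)) e v.
Proof. by rewrite /proj_normal proj_tangent_frame. Qed.

Lemma normal_vectorP n : normal_vector (G y) n <-> is_normal (inner (G y)) e n.
Proof.
split=> [nn i|nn u uP]; first exact: nn.
by rewrite -(frame_complete uP) (ip_normal_tangent (vp_at hL Uy) nn)// 
  (tangential_idem (vp_at hL Uy) orth).
Qed.

End Frame.

(** A field eta y = a *m \adj (G y) has covector eta y *m G y = \det (G y) a,
    so it is normal as soon as a vanishes on the slice; a is chosen so that
    eta x = d. *)
Lemma normal_extension x d : U x -> normal_vector (G x) d ->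
  exists eta : V -> V, [/\ smooth_on U eta, eta x = d &
    forall y, normal_vector (G y) (eta y)].
Proof.
move=> Ux nd; have oU := local_open hL.
have det0 : \det (G x) != 0 by have := metric_unit hL Ux;
  rewrite unitmxE unitfE.
pose a := (\det (G x))^-1 *: (d *m G x).
exists (fun y => a *m \adj (G y)); split.
- apply: (smooth_on_mx oU); apply: (smooth_mx_mul oU);
    first exact: smooth_mx_cst.
  by apply: (smooth_mx_adj oU); exact: (smooth_mx_metric hL).
- rewrite /a -scalemxAl -mulmxA mul_mx_adj mul_mx_scalar scalerA.
  by rewrite mulVf // scale1r.
move=> y u uP; rewrite /inner -(mulmxA a) mul_adj_mx mul_mx_scalar /a scalerA.
by rewrite -scalemxAl mxE -[X in _ * X]/(inner (G x) d u) nd // mulr0.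
Qed.

End Projections.

(** * The Weitzenbock formula in an adapted chart *)

Section LocalWeitzenbock.
Context {R : realType}.
Notation V := 'rV[R]_7.
Notation T := 'rV[R]_3.
Notation P := (slice_mx R).
Variables (U : set V) (G : V -> 'M[R]_7) (f : V -> V -> V -> V -> R).
Hypothesis hL : local_G2 U G f.
Notation Gam := (christoffel G).
Local Notation K x := (cross_of (G x) (f x)).
Hypothesis associative : forall y u v, U y -> (y <= P)%MS ->
  (u <= P)%MS -> (v <= P)%MS -> (K y u v <= P)%MS.
Variables (psi : V -> V) (O : set V) (e : 'I_3 -> V -> V).
Hypothesis spsi : smooth_along U psi.
Hypothesis oO : open O.
Hypothesis OU : O `<=` U.
Hypothesis se : forall i, smooth_along O (e i).
Hypothesis te : forall i y, O y -> (y <= P)%MS -> (e i y <= P)%MS.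
Hypothesis oe : forall i j y, O y -> (y <= P)%MS ->
  inner (G y) (e i y) (e j y) = (i == j)%:R.

Notation W := (slice_preimage U).
Notation WO := (slice_preimage O).

Let oW : open W := open_slice_preimage (local_open hL).
Let oWO : open WO := open_slice_preimage oO.
Let WOW t : WO t -> W t. Proof. exact: OU. Qed.

Definition slice_pull (s : V -> V) (t : T) : V := s (t *m P).
Definition frame_coord (i : 'I_3) (t : T) : T := e i (t *m P) *m P^T.

Let slice_t (t : T) : (t *m P <= P)%MS := submxMl t P.

Lemma frame_coordK i t : WO t -> frame_coord i t *m P = e i (t *m P).
Proof. by move=> Wt; rewrite /frame_coord sliceK // te. Qed.

Lemma differentiable_frame_coord i t : WO t -> differentiable (frame_coord i) t.
Proof.
move=> Wt; have s : smooth_on WO (frame_coord i).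
  apply: (smooth_on_mx oWO).
  apply: (smooth_mx_mul oWO); last exact: smooth_mx_cst.
  by move=> k l; apply: (smooth_on_entry _ _ oWO); exact: se.
exact: smooth_on_differentiable s Wt.
Qed.

(** The field nabla_{e_j} psi along the slice; [nabla_e_tan] are the slice
    coordinates of its tangential part and [nabla_e_perp] is its normal part. *)
Definition nabla_e j t : V := cov G (slice_pull psi) t (frame_coord j t).
Definition nabla_e_tan j t : T := nabla_e j t *m slice_coord_mx G (t *m P).
Definition nabla_e_perp j t : V := proj_normal (G (t *m P)) (nabla_e j t).

Lemma nabla_e_perpE j t : nabla_e_perp j t = nabla_e j t - nabla_e_tan j t *m P.
Proof. by rewrite /nabla_e_perp /proj_normal proj_tangentE. Qed.

Lemma differentiable_nabla_e j t : WO t -> differentiable (nabla_e j) t.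
Proof.
move=> Wt.
exact: (derive_cov_moving hL spsi (WOW Wt) (differentiable_frame_coord j Wt)).1.
Qed.

Lemma differentiable_nabla_e_tan j t : WO t -> differentiable (nabla_e_tan j) t.
Proof.
move=> Wt.
have [||| d _] := @derive_linear_family R 2 6 2 W
  (fun s u => u *m slice_coord_mx G (s *m P)) (nabla_e j) t oW (WOW Wt).
- by move=> y c u v _; rewrite mulmxDl scalemxAl.
- move=> u.
  have oU := local_open hL.
  have s : smooth_on U (fun y => u *m slice_coord_mx G y).
    apply: (smooth_on_mx oU); apply: (smooth_mx_mul oU).
      exact: smooth_mx_cst.
    exact: (smooth_slice_coord_mx hL).
  exact: (smooth_on_differentiable (smooth_on_comp_linear P s) (WOW Wt)).
- exact: differentiable_nabla_e.
exact: d.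
Qed.

Lemma differentiable_nabla_e_tanP j t : WO t ->
  differentiable (fun r => nabla_e_tan j r *m P) t.
Proof. by move=> Wt;
  exact: (cov_tangent G 0 (differentiable_nabla_e_tan j Wt)).1. Qed.

Lemma differentiable_nabla_e_perp j t : WO t ->
  differentiable (nabla_e_perp j) t.
Proof.
move=> Wt; have -> : nabla_e_perp j =
  (fun r => nabla_e j r - nabla_e_tan j r *m P).
  by apply/funext => r; exact: nabla_e_perpE.
apply: differentiableB;
  [exact: differentiable_nabla_e|exact: differentiable_nabla_e_tanP].
Qed.

Variable t : T.
Hypothesis Wt : WO t.
Notation x := (t *m P).

Let Ut : W t := WOW Wt.
Let vp : vector_product (inner (G x)) (K x) := vp_at hL Ut.
Let ex i := e i x.
Let exP i : (ex i <= P)%MS. Proof. exact: te. Qed.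
Let orth i j : inner (G x) (ex i) (ex j) = (i == j)%:R.
Proof. exact: oe. Qed.
Notation ip := (inner (G x)).
Notation N := (normal_part ip ex).
Notation tg := (tangential ip ex).

Let closed i j : tg (K x (ex i) (ex j)) = K x (ex i) (ex j).
Proof. by apply: (frame_complete hL) => //; exact: associative. Qed.

Let NE v : proj_normal (G x) v = N v.
Proof. by rewrite (proj_normal_frame hL Ut exP orth). Qed.

Let tgE v : proj_tangent (G x) v = tg v.
Proof. by rewrite (proj_tangent_frame hL Ut exP orth). Qed.

Let N_slice v : (v <= P)%MS -> N v = 0.
Proof. by move=> vP; apply: normal_part_tangent; exact: (frame_complete hL).
Qed.

Let frame_coord_t i : frame_coord i t *m P = ex i.
Proof. exact: frame_coordK. Qed.

Lemma nabla_frame i s :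
  nabla G (ex i) s x = cov G (slice_pull s) t (frame_coord i t).
Proof.
apply: etrans (congr1 (fun v => nabla G v s x) (esym (frame_coord_t i))) _.
exact: nabla_slice.
Qed.

Lemma nabla_perp_slice i s :
  nabla_perp G (ex i) s x = N (cov G (slice_pull s) t (frame_coord i t)).
Proof. by rewrite /nabla_perp nabla_frame NE. Qed.

Lemma nabla_tan_slice i s :
  nabla_tan G (ex i) s x = tg (cov G (slice_pull s) t (frame_coord i t)).
Proof. by rewrite /nabla_tan nabla_frame tgE. Qed.

(** nabla_{e_i} e_j at x. *)
Definition frame_deriv i j : V :=
  cov G (fun r => frame_coord j r *m P) t (frame_coord i t).
(** nabla_{e_i} (nabla^perp_{e_j} psi) at x. *)
Definition perp_deriv i j : V := cov G (nabla_e_perp j) t (frame_coord i t).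
(** The operator (nabla^perp)^2_{e_i, e_j} psi at x, by [nabla_perp2_frame]. *)
Definition normal_hessian i j : V :=
  N (perp_deriv i j) - \sum_k ip (frame_deriv i j) (ex k) *: nabla_e_perp k t.

Lemma nabla_e_perp_normal j : is_normal ip ex (nabla_e_perp j t).
Proof. by rewrite /nabla_e_perp NE; exact: (normal_part_normal vp orth). Qed.

Lemma normal_hessian_normal i j : is_normal ip ex (normal_hessian i j).
Proof.
move=> l; rewrite (ipDl vp) (ipNl vp) (normal_part_normal vp orth).
rewrite (big_morph (ip ^~ (ex l)) (fun u v => ipDl vp u v (ex l)) (ip0l vp _)).
by rewrite big1 ?subrr // => k _; rewrite (ipZl vp) nabla_e_perp_normal mulr0.
Qed.

(** Differentiate <e_j, e_k> = delta_jk. *)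
Lemma frame_deriv_anti i j k :
  ip (frame_deriv i j) (ex k) = - ip (frame_deriv i k) (ex j).
Proof.
have dep l : differentiable (fun r => frame_coord l r *m P) t.
  exact: (cov_tangent G 0 (differentiable_frame_coord l Wt)).1.
have := cov_inner hL (frame_coord i t) Ut (dep j) (dep k).
rewrite !frame_coord_t -/(frame_deriv i j) -/(frame_deriv i k)
  (vp_ipC vp (ex j)).
have -> : 'D_(frame_coord i t) (fun r =>
  inner (G (r *m P)) (frame_coord j r *m P) (frame_coord k r *m P)) t = 0.
  rewrite -(derive_cst ((j == k)%:R : R) t (frame_coord i t)).
  apply: near_eq_derive; apply: near_open_eq oWO Wt _ => r Wr.
  by rewrite !frame_coordK // oe.
by move/eqP; rewrite eq_sym addr_eq0 => /eqP.
Qed.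

Lemma nabla_perp_dir (c : 'I_3 -> R) :
  nabla_perp G (\sum_k c k *: ex k) psi x = \sum_k c k *: nabla_e_perp k t.
Proof.
have -> : \sum_k c k *: ex k = (\sum_k c k *: frame_coord k t) *m P.
  by rewrite mulmx_suml; apply: eq_bigr => k _;
    rewrite -scalemxAl frame_coord_t.
rewrite /nabla_perp nabla_slice NE -/(slice_pull psi).
have lin := @cov_linear _ _ _ _ hL _ spsi t.
have L0 : cov G (slice_pull psi) t 0 = 0.
  have := lin (-1) 0 0 Ut; rewrite scaleN1r oppr0 addr0 scaleN1r => ->.
  by rewrite addNr.
have N0 : N 0 = 0 by apply: N_slice; exact: sub0mx.
rewrite (big_morph (cov G (slice_pull psi) t) (id1 := 0) (op1 := +%R) _ L0);
  last first.
  by move=> u v; have := lin 1 u v Ut; rewrite !scale1r.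
rewrite (big_morph N (normal_partD vp ex) N0).
apply: eq_bigr => k _; rewrite /nabla_e_perp NE /nabla_e.
have := lin (c k) (frame_coord k t) 0 Ut; rewrite addr0 L0 addr0 => ->.
by rewrite (normal_partZ vp).
Qed.

Lemma nabla_perp_frame j r : WO r -> nabla_perp G (e j (r *m P)) psi (r *m P) =
  nabla_e_perp j r.
Proof.
move=> Wr.
apply: etrans (congr1 (fun v => nabla_perp G v psi (r *m P))
  (esym (frame_coordK j Wr))) _.
by rewrite /nabla_perp nabla_slice.
Qed.

Lemma nabla_perp2_frame i j :
  nabla_perp G (ex i) (fun y => nabla_perp G (e j y) psi y) x
    - nabla_perp G (nabla_tan G (ex i) (e j) x) psi x = normal_hessian i j.
Proof.
have E1 : nabla_perp G (ex i) (fun y => nabla_perp G (e j y) psi y) x =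
  N (perp_deriv i j).
  apply: etrans (nabla_perp_slice i _) _.
  apply: (congr1 (normal_part ip ex)).
  by apply: (cov_near G _ oWO Wt) => r Wr; exact: nabla_perp_frame.
have E2 : nabla_tan G (ex i) (e j) x =
  \sum_k ip (frame_deriv i j) (ex k) *: ex k.
  apply: etrans (nabla_tan_slice i _) _.
  apply: (congr1 (tangential ip ex)).
  by apply: (cov_near G _ oWO Wt) => r Wr; rewrite frame_coordK.
by rewrite E1 E2 nabla_perp_dir.
Qed.

Definition local_dirac (y : V) : V :=
  \sum_j K y (e j y) (nabla_perp G (e j y) psi y).

Lemma nabla_perp_dirac i :
  nabla_perp G (ex i) local_dirac x = \sum_j K x (ex j) (normal_hessian i j).
Proof.
have dep l : differentiable (fun r => frame_coord l r *m P) t.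
  exact: (cov_tangent G 0 (differentiable_frame_coord l Wt)).1.
have dK j := cov_cross hL Ut (dep j) (differentiable_nabla_e_perp j Wt).
rewrite nabla_perp_slice.
have -> : cov G (slice_pull local_dirac) t (frame_coord i t) =
    \sum_j (K x (frame_deriv i j) (nabla_e_perp j t)
      + K x (ex j) (perp_deriv i j)).
  apply: etrans (_ :
    cov G (fun r => \sum_j K (r *m P) (frame_coord j r *m P) (nabla_e_perp j r))
      t (frame_coord i t) = _).
    apply: (cov_near G _ oWO Wt) => r Wr; apply: eq_bigr => j _.
    by rewrite nabla_perp_frame // frame_coordK.
  rewrite (cov_sum hL _ Ut); last by move=> j; exact: (dK j).1.
  by apply: eq_bigr => j _; rewrite (dK j).2 frame_coord_t.
apply: (dirac_derivative vp orth closed) => //.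
- by move=> j k; exact: frame_deriv_anti.
- exact: nabla_e_perp_normal.
Qed.

(** A(psi)(e_i), by [shape_vecE]. *)
Definition shape_vec i : V := - (nabla_e_tan i t *m P).

Lemma shape_vecE i : shape_op G psi x (ex i) = shape_vec i.
Proof.
by rewrite /shape_op /nabla_tan nabla_frame proj_tangentE.
Qed.

(** The Ricci equation. Write nabla^perp psi = nabla psi - nabla^T psi. The
    second derivatives of psi antisymmetrize to the curvature, split by the
    Bianchi identity; the derivative of the tangent field nabla^T_{e_j} psi has
    normal part B(e_i, nabla^T_{e_j} psi), where B(u, v) is the normal part of
    the Christoffel symbol; the remaining first-order terms cancel since the
    connection is torsion free. *)
Lemma normal_hessian_comm i j : normal_hessian i j - normal_hessian j i =
  N (curv G x (ex i) (psi x) (ex j) - curv G x (ex j) (psi x) (ex i))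
  - (N (Gam x (shape_vec i) (ex j)) - N (Gam x (shape_vec j) (ex i))).
Proof.
have perp_derivE a b : perp_deriv a b = cov G (nabla_e b) t (frame_coord a t)
     - ('D_(frame_coord a t) (nabla_e_tan b) t *m P
         - Gam x (ex a) (shape_vec b)).
  have dYb := differentiable_nabla_e b Wt;
    have dZb := differentiable_nabla_e_tanP b Wt.
  rewrite /perp_deriv (cov_near G (frame_coord a t) oWO Wt (fun r _ =>
    nabla_e_perpE b r)).
  rewrite (covD hL _ Ut dYb (differentiableN dZb)) (covN hL _ Ut dZb).
  rewrite (cov_tangent G (frame_coord a t) (differentiable_nabla_e_tan b Wt)).2
    frame_coord_t /shape_vec.
  by rewrite (christoffelNr hL _ _ Ut) opprK.
have NB a b : N ('D_(frame_coord a t) (nabla_e_tan b) t *m P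
  - Gam x (ex a) (shape_vec b)) =
    - N (Gam x (shape_vec b) (ex a)).
  rewrite (normal_partD vp) (N_slice (slice_t _)) add0r (normal_partN vp).
  by rewrite (christoffelC hL (ex a) _ Ut).
have C := cov_commutator hL spsi Ut (differentiable_frame_coord i Wt)
  (differentiable_frame_coord j Wt).
have Tor := torsion_free hL Ut (differentiable_frame_coord i Wt)
  (differentiable_frame_coord j Wt).
rewrite -/(frame_deriv i j) -/(frame_deriv j i) in Tor.
rewrite !frame_coord_t (curv_bianchi hL _ _ _ Ut) in C.
set w := 'D_(frame_coord i t) (frame_coord j) t
  - 'D_(frame_coord j t) (frame_coord i) t in C Tor.
have Nw : N (cov G (slice_pull psi) t w) =
  \sum_k ip (frame_deriv i j - frame_deriv j i) (ex k) *: nabla_e_perp k t.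
  rewrite -nabla_perp_dir
    -/(tangential ip ex (frame_deriv i j - frame_deriv j i)) Tor.
  by rewrite (frame_complete hL) // /nabla_perp nabla_slice NE.
have HE a b : normal_hessian a b =
  N (cov G (nabla_e b) t (frame_coord a t)) + N (Gam x (shape_vec b) (ex a))
    - \sum_k ip (frame_deriv a b) (ex k) *: nabla_e_perp k t.
  by rewrite /normal_hessian perp_derivE (normal_partD vp) (normal_partN vp) NB
    opprK.
have SE : \sum_k ip (frame_deriv i j - frame_deriv j i) (ex k) *:
  nabla_e_perp k t =
    \sum_k ip (frame_deriv i j) (ex k) *: nabla_e_perp k t
      - \sum_k ip (frame_deriv j i) (ex k) *: nabla_e_perp k t.
  rewrite -sumrB; apply: eq_bigr => k _.
  by rewrite (ipDl vp) (ipNl vp) scalerBl.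
have NC : N (cov G (nabla_e j) t (frame_coord i t))
  - N (cov G (nabla_e i) t (frame_coord j t)) =
    N (curv G x (ex i) (psi x) (ex j) - curv G x (ex j) (psi x) (ex i))
    + (\sum_k ip (frame_deriv i j) (ex k) *: nabla_e_perp k t
        - \sum_k ip (frame_deriv j i) (ex k) *: nabla_e_perp k t).
  rewrite -SE -Nw -(normal_partD vp) -(normal_partN vp) -(normal_partD vp).
  by congr (N _); exact: C.
have key (y1 y2 rr s1 s2 g1 g2 : V) : y1 - y2 = rr + (s1 - s2) ->
    y1 + g1 - s1 - (y2 + g2 - s2) = rr - (g2 - g1).
  by move=> /rowP E; apply/rowP => k; have := E k; rewrite !mxE; lra.
by rewrite !HE; exact: key NC.
Qed.

(** Along the slice the product of two constant tangent fields stays tangent, so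
    the left-hand side of [derive_cross] has no normal part. *)
Lemma second_form_derivation a u v : (a <= P)%MS -> (u <= P)%MS ->
  (v <= P)%MS ->
  N (Gam x a (K x u v)) = N (K x (Gam x a u) v) + N (K x u (Gam x a v)).
Proof.
move=> aP uP vP.
have D := derive_cross hL a u v Ut.
have ND : N ('D_a (fun y => K y u v) x) = 0.
  have -> : 'D_a (fun y => K y u v) x =
      'D_(a *m P^T) (fun r => K (r *m P) u v *m P^T *m P) t.
    rewrite -[a in LHS](sliceK aP) -derive_comp_linear.
    apply: near_eq_derive; apply: near_open_eq oW Ut _ => r Wr.
    by rewrite sliceK // associative.
  apply: N_slice.
  have dc : differentiable (fun r : T => K (r *m P) u v *m P^T) t.
    have s : smooth_on U (fun y => K y u v *m P^T).
      have oU := local_open hL.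
      apply: (smooth_on_mx oU); apply: (smooth_mx_mul oU);
        last exact: smooth_mx_cst.
      exact: smooth_mx_cross hL _ _.
    exact: (smooth_on_differentiable (smooth_on_comp_linear P s) Ut).
  have [_] := cov_tangent G (a *m P^T) dc.
  rewrite /cov => /(addIr _) ->; exact: submxMl.
rewrite D (normal_partD vp) (normal_partD vp) (normal_partN vp) in ND.
by move/eqP: ND; rewrite subr_eq0 => /eqP.
Qed.

Lemma local_weitzenbock :
  \sum_i K x (ex i) (nabla_perp G (ex i) local_dirac x) =
  - (\sum_i normal_hessian i i)
  + N (\sum_i curv G x (ex i) (psi x) (ex i))
  - \sum_i N (Gam x (shape_vec i) (ex i)).
Proof.
have [lam ll [E01 E12 E20]] := frame_cross vp orth closed.
under eq_bigr do rewrite nabla_perp_dirac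
  (big_morph (K x (ex _)) (fun u v => crDr vp u v (ex _)) (cr0r vp (ex _))).
have sP i : (shape_vec i <= P)%MS by rewrite /shape_vec -mulNmx submxMl.
pose r i j := curv G x (ex i) (psi x) (ex j).
pose s i j := N (Gam x (shape_vec i) (ex j)).
have rD i j k l : K x (ex j) (ex k) = lam *: ex l ->
    lam *: r i l = K x (r i j) (ex k) + K x (ex j) (r i k).
  move=> E; rewrite /r -(curvZ hL _ _ _ _ Ut) -E.
  exact: (curv_cross hL).
have sD i j k l : K x (ex j) (ex k) = lam *: ex l ->
    lam *: s i l = K x (s i j) (ex k) + K x (ex j) (s i k).
  move=> E; rewrite /s -(normal_partZ vp) -(christoffelZr hL _ _ _ Ut) -E.
  rewrite second_form_derivation // (normal_part_cr_frame vp orth closed).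
  by rewrite (vp_crC vp) (normal_partN vp) (normal_part_cr_frame vp orth closed)
    -(vp_crC vp).
apply: (weitzenbock_sum vp orth closed (r := r) (s := s) ll E01 E12 E20).
- exact: normal_hessian_normal.
- by move=> i j; exact: (normal_part_normal vp orth).
- exact: rD.
- exact: rD.
- exact: rD.
- exact: sD.
- exact: sD.
- exact: sD.
- exact: normal_hessian_comm.
Qed.

Lemma ip_shape_vec i : ip (shape_vec i) =1 fun v => ip (shape_vec i) (tg v).
Proof.
move=> v; rewrite -[v in LHS](subrK (tg v)) (ipDr vp).
have sP : (shape_vec i <= P)%MS by rewrite /shape_vec -mulNmx submxMl.
rewrite (vp_ipC vp) (ip_normal_tangent vp (normal_part_normal vp orth v))
  ?add0r //.
by rewrite (frame_complete hL Ut exP orth).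
Qed.

(** The vector A(psi)(e_i), extended by a constant, stays tangent to the slice:
    differentiating <eta, A(psi)(e_i)> = 0 along e_i gives
    <A(eta)(e_i), A(psi)(e_i)> = <B(e_i, A(psi)(e_i)), eta>. *)
Lemma trace_shape (O' : set V) (eta : V -> V) : open O' -> O' x -> O' `<=` U ->
  smooth_along O' eta ->
  (forall y, O' y -> (y <= P)%MS -> normal_vector (G y) (eta y)) ->
  ip (\sum_i N (Gam x (shape_vec i) (ex i))) (eta x) =
  trace_inner (G x) ex (shape_op G psi x) (shape_op G eta x).
Proof.
move=> oO' O'x O'U seta neta.
have oWO' := open_slice_preimage oO'.
have deta : differentiable (slice_pull eta) t :=
  smooth_on_differentiable seta O'x.
have neta_x : is_normal ip ex (eta x) by move=> i; exact: neta.
rewrite (big_morph (ip ^~ (eta x)) (fun u v => ipDl vp u v _) (ip0l vp _)).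
apply: eq_bigr => i _; rewrite shape_vecE /shape_op nabla_tan_slice.
rewrite (ipNr vp) -ip_shape_vec.
have D := cov_inner hL (frame_coord i t) Ut deta
  (differentiable_cst (shape_vec i) t).
have sP : (shape_vec i <= P)%MS by rewrite /shape_vec -mulNmx submxMl.
have E0 : 'D_(frame_coord i t) (fun r =>
  inner (G (r *m P)) (slice_pull eta r) (cst (shape_vec i) r)) t = 0.
  rewrite -(derive_cst (0 : R) t (frame_coord i t)).
  apply: near_eq_derive; apply: near_open_eq oWO' O'x _ => r O'r.
  exact: neta.
rewrite E0 /= in D.
have Ec : cov G (cst (shape_vec i)) t (frame_coord i t) =
  Gam x (shape_vec i) (ex i).
  by rewrite /cov derive_cst add0r frame_coord_t (christoffelC hL _ _ Ut).
rewrite Ec in D.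
have -> : ip (N (Gam x (shape_vec i) (ex i))) (eta x) =
  ip (Gam x (shape_vec i) (ex i)) (eta x).
  rewrite /normal_part (ipDl vp) (ipNl vp) (vp_ipC vp (tg _)).
  by rewrite (ip_normal_tangent vp neta_x) ?subr0 // (tangential_idem vp orth).
rewrite (vp_ipC vp) (vp_ipC vp (shape_vec i)).
by move/eqP: D; rewrite eq_sym addrC addr_eq0 => /eqP.
Qed.

(** For uniqueness, two candidates are compared on a normal field that extends
    their difference. *)
Lemma local_shape_squared :
  xget 0 [set n : V | normal_vector (G x) n /\
    forall (O' : set V) (eta : V -> V),
      open O' -> O' x -> O' `<=` U -> smooth_along O' eta ->
      (forall y, O' y -> (y <= P)%MS -> normal_vector (G y) (eta y)) ->
      ip n (eta x) =
      trace_inner (G x) ex (shape_op G psi x) (shape_op G eta x)] =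
  \sum_i N (Gam x (shape_vec i) (ex i)).
Proof.
have nvP := normal_vectorP hL Ut exP orth.
apply: xget_unique.
  split; last exact: trace_shape.
  apply/nvP => j.
  rewrite (big_morph (ip ^~ (ex j)) (fun u v => ipDl vp u v _) (ip0l vp _)).
  by rewrite big1 // => i _; exact: (normal_part_normal vp orth).
move=> n [nn En].
set m := \sum_i _.
have nm : is_normal ip ex m.
  move=> j; rewrite /m (big_morph (ip ^~ (ex j)) (fun u v => ipDl vp u v _)
    (ip0l vp _)).
  by rewrite big1 // => i _; exact: (normal_part_normal vp orth).
have nd : normal_vector (G x) (n - m).
  by apply/nvP => j; rewrite (ipDl vp) (ipNl vp) nm (nn _ (exP j)) subr0.
have [eta [seta eta_x neta]] := normal_extension hL Ut nd.
have oU := local_open hL.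
have sa : smooth_along U eta := smooth_on_comp_linear P seta.
have E1 := En U eta oU Ut (fun _ => id) sa (fun y _ _ => neta y).
have E2 := trace_shape oU Ut (fun _ => id) sa (fun y _ _ => neta y).
rewrite -E2 eta_x in E1.
apply/eqP; rewrite -subr_eq0; apply/negPn/negP => /(vp_ip_gt0 vp).
by rewrite {1}(ipDl vp) (ipNl vp) E1 subrr ltxx.
Qed.

End LocalWeitzenbock.

(** * Passing to the manifold *)

Lemma open_chart_image (R : realType) (M : topologicalType) (c : chart R M)
    (O : set M) : open O -> open (chart_image c O).
Proof.
move=> oO.
have E : chart_image c O =
    (chart_coord c @` chart_dom c) `&` (chart_inv c @^-1` O).
  apply/seteqP; split=> y /=.
    by move=> [p [dp Op] <-]; split; [exists p|rewrite /= chart_coordK].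
  by move=> [[p dp <-]]; rewrite /= chart_coordK // => Op; exists p.
rewrite E openE => y [cy Oy].
apply: filterI.
  by apply: open_nbhs_nbhs; split; [exact: chart_image_open|].
apply: (chart_inv_continuous cy).
by apply: open_nbhs_nbhs.
Qed.

Lemma adapted_preimage (R : realType) (M : topologicalType)
    (atlas : set (chart R M)) (Y O : set M) (c : chart R M) y :
  adapted atlas Y c -> chart_image c O y -> (y <= slice_mx R)%MS ->
  exists p, [/\ chart_dom c p, Y p, O p & y = chart_coord c p].
Proof.
by move=> [_ ad] [p [dp Op] <-] yP; exists p; split=> //; apply/ad.
Qed.

Lemma chart_local_G2 (R : realType) (M : topologicalType)
    (atlas : set (chart R M)) (g : metric_field R M) (phi : form3_field R M)
    (c : chart R M) :
  riemannian_metric atlas g -> parallel_G2_form atlas g phi -> atlas c ->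
  local_G2 (chart_image c setT) (g c) (phi c).
Proof.
move=> hg hphi ac; split.
- exact/open_chart_image/openT.
- exact: (metric_smooth hg).
- by move=> _ [p [dp _] <-]; exact: (Defs.metric_sym hg ac dp).
- by move=> u v w; exact: (form_smooth hphi _ _ _ ac).
- by move=> _ [p [dp _] <-]; exact: (form_G2 hphi ac dp).
- by move=> x z u v w Ux; exact: (form_parallel hphi _ _ _ _ ac Ux).
Qed.

Theorem theorem1p2 (R : realType) (M : topologicalType)
    (atlas : set (chart R M)) (g : metric_field R M) (phi : form3_field R M)
    (Y : set M)
    (hM : smooth_manifold atlas)
    (hg : riemannian_metric atlas g)
    (hphi : parallel_G2_form atlas g phi)
    (hY : associative_submanifold atlas g phi Y)
    (psi : tm_field R M) (hpsi : normal_section atlas g Y setT psi)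
    (O : set M) (hO : open O) (e : 'I_3 -> tm_field R M)
    (he : orthonormal_frame atlas g Y O e)
    (c : chart R M) (hc : adapted atlas Y c)
    (p : M) (hpc : chart_dom c p) (hpY : Y p) (hpO : O p) :
  dirac_op g phi e (dirac_op g phi e psi) c (chart_coord c p) =
  rough_laplacian g e psi c (chart_coord c p)
  + ricci_normal g e psi c (chart_coord c p)
  - shape_squared g e psi c (chart_coord c p).
Proof.
have hL := chart_local_G2 hg hphi hc.1.
set U := chart_image c setT in hL.
pose G := g c; pose f := phi c.
have assoc y u v : U y -> (y <= slice_mx R)%MS -> (u <= slice_mx R)%MS ->
    (v <= slice_mx R)%MS -> (cross_of (G y) (f y) u v <= slice_mx R)%MS.
  move=> Uy yP uP vP; have [q [dq Yq _ ->]] := adapted_preimage hc Uy yP.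
  exact: hY.2 hc dq Yq uP vP.
have spsi : smooth_along U (psi c) by exact: hpsi.1.1.
pose O' := chart_image c O.
have oO' : open O' by exact: open_chart_image.
have O'U : O' `<=` U by move=> _ [q [dq _] <-]; exists q.
have se i : smooth_along O' (e i c) by exact: (he.1 i).1.1.
have te i y : O' y -> (y <= slice_mx R)%MS -> (e i c y <= slice_mx R)%MS.
  move=> Oy yP; have [q [dq Yq Oq ->]] := adapted_preimage hc Oy yP.
  exact: (he.1 i).2.
have oe i j y : O' y -> (y <= slice_mx R)%MS ->
    inner (G y) (e i c y) (e j c y) = (i == j)%:R.
  move=> Oy yP; have [q [dq Yq Oq ->]] := adapted_preimage hc Oy yP.
  exact: he.2.
pose t := chart_coord c p *m (slice_mx R)^T.
have xE : t *m slice_mx R = chart_coord c p.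
  by apply: sliceK; apply/(hc.2 p hpc).
have Wt : slice_preimage O' t by rewrite /slice_preimage /= xE; exists p.
have Ut : U (chart_coord c p) by exists p.
have D := local_weitzenbock hL assoc spsi oO' O'U se te oe Wt.
have S := local_shape_squared hL (psi c) O'U te oe Wt.
have H i := nabla_perp2_frame hL spsi oO' O'U te oe Wt i i.
have N v := proj_normal_frame hL (O'U _ Wt) (fun i => te i _ Wt (submxMl _ _))
  (fun i j => oe i j _ Wt (submxMl _ _)) v.
rewrite -S -N in D.
rewrite xE in D H.
have Lap : rough_laplacian g e psi c (chart_coord c p) =
    - \sum_i normal_hessian G (psi c) (fun i => e i c) t i i.
  by congr (- _); apply: eq_bigr => i _; exact: H.
have Ric : ricci_normal g e psi c (chart_coord c p) =
    proj_normal (G (chart_coord c p)) (\sum_i curv G (chart_coord c p)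
      (e i c (chart_coord c p)) (psi c (chart_coord c p))
      (e i c (chart_coord c p))).
  congr proj_normal; apply: eq_bigr => i _;
    exact: (curvature_tensorE hL _ _ _ Ut).
by rewrite Lap Ric; exact: D.
Qed.
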